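(* Let $1 \le q \le \infty$, with the convention $1/q = 0$ (and $n/q = 0$, etc.) when $q = \infty$. Then for every integer $n \ge 1$, $$\mathbb{E} V_{B_q^n}^2 = \frac{1}{n!}\left(\frac{\Gamma(1+\frac{3}{q})\,\Gamma(1+\frac{n}{q})}{3\,\Gamma(1+\frac{1}{q})^3\,\Gamma(1+\frac{n+2}{q})}\right)^n \Gamma\left(1+\frac{n}{q}\right)^2,$$ and for every integer $n \ge 2$, $$\mathbb{E} V_{B_q^n}^4 = \frac{(n+1)(n+2)}{2(n!)^2}\left(\frac{\Gamma(1+\frac{3}{q})^2\,\Gamma(1+\frac{n}{q})}{9\,\Gamma(1+\frac{1}{q})^6\,\Gamma(1+\frac{n+4}{q})}\right)^n \Gamma\left(1+\frac{n}{q}\right)^4 \varphi(A_q-3,n),$$ where $$A_q = \frac{9\,\Gamma(1+\frac{1}{q})\,\Gamma(1+\frac{5}{q})}{5\,\Gamma(1+\frac{3}{q})^2}$$ and $$\varphi(t,n) = \left(1-\frac{2t}{n+2}+\frac{t^2}{(n+1)(n+2)}\right)\sum_{k=0}^n\frac{t^k}{k!}+\frac{t^{n+1}}{(n+1)!}-\frac{t^{n+2}}{(n+2)!}.$$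
   Context: $B_q^n = \{x \in \mathbb{R}^n : \sum_{i=1}^n |x_i|^q \le 1\}$ for $1 \le q < \infty$, and $B_\infty^n = \{x \in \mathbb{R}^n : \max_i |x_i| \le 1\}$. For a symmetric convex body $K \subset \mathbb{R}^n$ (compact, convex, with nonempty interior, $K = -K$), $V_K$ is the random variable $$V_K = \frac{1}{|K|}\,\bigl|\mathrm{conv}\{\pm x_1,\ldots,\pm x_n\}\bigr|,$$ where $x_1,\ldots,x_n$ are independent random points uniformly distributed in $K$ and $|\cdot|$ denotes volume ($n$-dimensional Lebesgue measure). $\Gamma$ is the Gamma function. *)

(* Defs.v *)
From HB Require Import structures.
From mathcomp Require Import all_boot all_order all_algebra.
From mathcomp Require Import all_classical all_reals all_analysis.
Import Order.TTheory GRing.Theory Num.Theory.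
Import numFieldNormedType.Exports.

Set Implicit Arguments.
Unset Strict Implicit.
Unset Printing Implicit Defensive.

Local Open Scope classical_set_scope.
Local Open Scope ring_scope.

(* Borel sigma-algebra of R^n: the one generated by the coordinates, exactly
   as for n.-tuple. *)
Section measurable_rV.
Context (R : realType) (n : nat).

Let coord (i : 'I_n) (x : 'rV[R]_n) : measurableTypeR R := x ord0 i.

Let rV_set0 : g_sigma_preimage coord set0.
Proof. exact: sigma_algebra0. Qed.

Let rV_setC A : g_sigma_preimage coord A -> g_sigma_preimage coord (~` A).
Proof. exact: sigma_algebraC. Qed.

Let rV_bigcup (F : (set 'rV[R]_n)^nat) :
  (forall i, g_sigma_preimage coord (F i)) ->
  g_sigma_preimage coord (\bigcup_i (F i)).
Proof. exact: sigma_algebra_bigcup. Qed.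

HB.instance Definition _ := @isMeasurable.Build
  (measure_tuple_display default_measure_display)
  'rV[R]_n (g_sigma_preimage coord) rV_set0 rV_setC rV_bigcup.

Lemma measurable_coord (i : 'I_n) :
  measurable_fun [set: 'rV[R]_n] (fun x => x ord0 i : measurableTypeR R).
Proof.
move=> _ Y mY; rewrite setTI; apply: sub_sigma_algebra => /=.
rewrite -bigcup_seq/=; exists i => /=; first by rewrite mem_index_enum.
by exists Y => //; rewrite setTI.
Qed.

Lemma measurable_fun_rVP d (T : measurableType d) (f : T -> 'rV[R]_n) :
  (forall i, measurable_fun [set: T] (fun t => f t ord0 i : measurableTypeR R)) ->
  measurable_fun [set: T] f.
Proof.
move=> mf _ Y mY; rewrite setTI.
have : g_sigma_preimage coord `<=` [set A | measurable (f @^-1` A)].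
  apply: smallest_sub.
    split => /=.
    - by rewrite preimage_set0.
    - by move=> A mA; rewrite setTD preimage_setC; exact: measurableC.
    - by move=> F mF; rewrite preimage_bigcup; exact: bigcup_measurable.
  rewrite -bigcup_seq => A [i _ [B mB <-]] /=; rewrite setTI.
  by rewrite -[X in measurable X]setTI; exact: mf.
exact.
Qed.

End measurable_rV.

(* Lebesgue measure on R^n, by recursion on n: the product of the Lebesgue
   measures of R and R^n, transported along the identification
   (a, x) |-> row_mx a x of R * R^n with R^n.+1. *)
Section lebesgue_rV.
Context {R : realType}.

Definition cons_rV n (z : measurableTypeR R * 'rV[R]_n) : 'rV[R]_n.+1 :=
  row_mx (z.1%:M : 'rV_1) z.2.

Lemma cons_rV0 n z : @cons_rV n z ord0 ord0 = z.1.
Proof.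
transitivity ((z.1%:M : 'rV[R]_1) ord0 ord0); last by rewrite mxE.
rewrite -[RHS](row_mxEl _ z.2); apply: congr1; exact/val_inj.
Qed.

Lemma cons_rV_lift n z (i : 'I_n) : @cons_rV n z ord0 (lift ord0 i) = z.2 ord0 i.
Proof.
rewrite -[RHS](row_mxEr (z.1%:M : 'rV[R]_1)); apply: congr1; exact/val_inj.
Qed.

Lemma measurable_cons_rV n : measurable_fun setT (@cons_rV n).
Proof.
apply: measurable_fun_rVP => i.
case: (unliftP ord0 i) => [j|] ->.
  rewrite (_ : (fun _ => _) = (fun x : 'rV[R]_n => x ord0 j) \o snd).
    by apply: measurableT_comp; [exact: measurable_coord|
      exact: measurable_snd].
  by apply/funext => z /=; rewrite cons_rV_lift.
rewrite (_ : (fun _ => _) = fst); first exact: measurable_fst.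
by apply/funext => z; rewrite cons_rV0.
Qed.

HB.instance Definition _ n :=
  isMeasurableFun.Build _ _ _ _ (@cons_rV n) (@measurable_cons_rV n).

Definition uncons_rV n (x : 'rV[R]_n.+1) : measurableTypeR R * 'rV[R]_n :=
  (x ord0 ord0, \row_i x ord0 (lift ord0 i)).

Lemma measurable_uncons_rV n : measurable_fun setT (@uncons_rV n).
Proof.
apply: measurable_fun_pair; first exact: measurable_coord.
apply: measurable_fun_rVP => i.
rewrite (_ : (fun _ => _) = fun x : 'rV[R]_n.+1 => x ord0 (lift ord0 i)).
  exact: measurable_coord.
by apply/funext => x; rewrite mxE.
Qed.

Lemma cons_rVK n : cancel (@cons_rV n) (@uncons_rV n).
Proof.
move=> [a x]; rewrite /uncons_rV cons_rV0; congr (_, _).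
by apply/rowP => i; rewrite mxE cons_rV_lift.
Qed.

Definition cons_lebesgue n
    (m : {sigma_finite_measure set 'rV[R]_n -> \bar R}) :
    set 'rV[R]_n.+1 -> \bar R :=
  pushforward (@lebesgue_measure R \x m)%E (@cons_rV n).

Section cons_lebesgue_measure.
Context n (m : {sigma_finite_measure set 'rV[R]_n -> \bar R}).

Lemma cons_lebesgue0 : cons_lebesgue m set0 = 0%E.
Proof. by rewrite /cons_lebesgue /pushforward preimage_set0 measure0. Qed.

Lemma cons_lebesgue_ge0 A : (0 <= cons_lebesgue m A)%E.
Proof. exact: measure_ge0. Qed.

Lemma cons_lebesgue_sigma_additive : semi_sigma_additive (cons_lebesgue m).
Proof.
move=> F mF tF mUF; rewrite /cons_lebesgue /pushforward preimage_bigcup.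
have mp A : measurable A -> measurable (@cons_rV n @^-1` A).
  by move=> mA; rewrite -[X in measurable X]setTI; exact: measurable_cons_rV.
apply: (@measure_semi_sigma_additive _ _ _ (@lebesgue_measure R \x m)%E) => [k||].
- exact: mp.
- apply/trivIsetP => /= i j _ _ ij; rewrite -preimage_setI.
  by move/trivIsetP : tF => /(_ _ _ _ _ ij) ->//; rewrite preimage_set0.
- by rewrite -preimage_bigcup; exact: mp.
Qed.

Lemma sigma_finite_cons_lebesgue : sigma_finite setT (cons_lebesgue m).
Proof.
have /sigma_finiteP[F [TF ndF Foo]] := sigma_finiteT (@lebesgue_measure R).
have /sigma_finiteP[G [TG ndG Goo]] := sigma_finiteT m.
exists (fun k => @uncons_rV n @^-1` (F k `*` G k)).
  rewrite -preimage_bigcup (_ : \bigcup_k _ = setT) ?preimage_setT//.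
  apply/seteqP; split => // -[a x] _.
  have [i _ Fia] : (\bigcup_k F k) a by rewrite -TF.
  have [j _ Gjx] : (\bigcup_k G k) x by rewrite -TG.
  exists (maxn i j) => //; split => /=.
  - by move: a Fia; exact/subsetPset/ndF/leq_maxl.
  - by move: x Gjx; exact/subsetPset/ndG/leq_maxr.
move=> k; have [mF Fk] := Foo k; have [mG Gk] := Goo k; split.
  rewrite -[X in measurable X]setTI.
  by apply: measurable_uncons_rV => //; exact: measurableX.
rewrite /cons_lebesgue /pushforward -comp_preimage (_ : _ \o _ = id); last first.
  by apply/funext => z /=; rewrite cons_rVK.
by rewrite preimage_id product_measure1E// lte_mul_pinfty// ge0_fin_numE.
Qed.

End cons_lebesgue_measure.

HB.instance Definition _ n (m : {sigma_finite_measure set 'rV[R]_n -> \bar R}) :=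
  isMeasure.Build _ _ _ (cons_lebesgue m)
    (cons_lebesgue0 m) (cons_lebesgue_ge0 m)
    (@cons_lebesgue_sigma_additive n m).
HB.instance Definition _ n (m : {sigma_finite_measure set 'rV[R]_n -> \bar R}) :=
  Measure_isSigmaFinite.Build _ _ _ (cons_lebesgue m)
    (sigma_finite_cons_lebesgue m).

Fixpoint lebesgue_rV n : {sigma_finite_measure set 'rV[R]_n -> \bar R} :=
  if n is n'.+1 then cons_lebesgue (lebesgue_rV n') else dirac (0 : 'rV[R]_0).

End lebesgue_rV.

Lemma lebesgue_rV_box (R : realType) n (A : 'I_n -> set (measurableTypeR R)) :
  (forall i, measurable (A i)) ->
  lebesgue_rV n [set x | forall i, A i (x ord0 i)] =
  (\prod_(i < n) lebesgue_measure (A i))%E.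
Proof.
elim: n A => [|n IHn] A mA.
  by rewrite big_ord0 /= diracE mem_set//= => -[].
set B := [set x : 'rV[R]_n | forall i, A (lift ord0 i) (x ord0 i)].
have mB : measurable B.
  rewrite (_ : B = \bigcap_(i in [set: 'I_n])
      (fun x : 'rV[R]_n => x ord0 i : measurableTypeR R) @^-1` A (lift ord0 i)).
    apply: fin_bigcap_measurable => // i _.
    by rewrite -[X in measurable X]setTI; exact: measurable_coord.
  by apply/seteqP; split => x /= xA i; [move=> _|]; exact: xA.
rewrite big_ord_recl -IHn// -product_measure1E//.
apply: (congr1 (@lebesgue_measure R \x lebesgue_rV n)%E).
apply/seteqP; split => -[a x] /=.
  move=> Ax; split; first by have := Ax ord0; rewrite cons_rV0.
  by move=> i; have := Ax (lift ord0 i); rewrite cons_rV_lift.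
move=> [Aa Ax] i; case: (unliftP ord0 i) => [j|] ->.
  by rewrite cons_rV_lift; exact: Ax.
by rewrite cons_rV0.
Qed.

Definition mutually_independent d d' (T : measurableType d)
    (T' : measurableType d') (R : realType) (P : probability T R) (n : nat)
    (X : 'I_n -> {RV P >-> T'}) : Prop :=
  forall (I : {set 'I_n}) (A : 'I_n -> set T'), (forall i, measurable (A i)) ->
  P (\bigcap_(i in [set i | i \in I]) X i @^-1` A i) =
  (\prod_(i in I) P (X i @^-1` A i))%E.

Definition uniformly_distributed d (T : measurableType d) (R : realType)
    (P : probability T R) (n : nat) (X : {RV P >-> 'rV[R]_n})
    (K : set 'rV[R]_n) : Prop :=
  forall A, measurable A ->
  distribution P X A = (lebesgue_rV n (A `&` K) / lebesgue_rV n K)%E.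

Definition convex_hull (R : realType) n (S : set 'rV[R]_n) : set 'rV[R]_n :=
  smallest (@convex_set R 'rV[R]_n) S.

(* V_K as a function of the points x_1, ..., x_n. *)
Definition relative_volume (R : realType) n (K : set 'rV[R]_n)
    (x : 'I_n -> 'rV[R]_n) : R :=
  (fine (lebesgue_rV n K))^-1 *
  fine (lebesgue_rV n (convex_hull [set y | exists i, y = x i \/ y = - x i])).

(* The last branch is q = +oo; q = -oo is excluded by 1 <= q. *)
Definition lq_ball (R : realType) (q : \bar R) (n : nat) : set 'rV[R]_n :=
  match q with
  | r%:E => [set x | \sum_(i < n) `|x ord0 i| `^ r <= 1]
  | _ => [set x | \big[Num.max/0]_(i < n) `|x ord0 i| <= 1]
  end.
Arguments lq_ball {R} q n _.

Definition Gamma (R : realType) (s : R) : R :=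
  \int[lebesgue_measure]_(x in `]0, +oo[) (x `^ (s - 1) * expR (- x)).

(* 1/q, equal to 0 for q = +oo *)
Definition recip (R : realType) (q : \bar R) : R := fine (q^-1)%E.

Definition A_ (R : realType) (q : \bar R) : R :=
  let p := recip q in
  9 * Gamma (1 + p) * Gamma (1 + 5 * p) / (5 * Gamma (1 + 3 * p) ^+ 2).

Definition phi (R : realType) (t : R) (n : nat) : R :=
  (1 - 2 * t / n.+2%:R + t ^+ 2 / (n.+1%:R * n.+2%:R)) *
    (\sum_(0 <= k < n.+1) t ^+ k / k`!%:R)
  + t ^+ n.+1 / n.+1`!%:R - t ^+ n.+2 / n.+2`!%:R.

(* Main.v *)
Require Import Defs.
From HB Require Import structures.
From mathcomp Require Import all_boot all_order all_fingroup all_algebra.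
From mathcomp Require Import all_classical all_reals all_analysis.
From mathcomp Require Import measurable_realfun ring lra zify.
Import Order.TTheory GRing.Theory Num.Theory.
Import numFieldNormedType.Exports HBNNSimple.

(** The convex hull of +-x_1, ..., +-x_n is the image of the unit ball of l_1^n,
of volume 2^n / n!, under c |-> c *m A, where A is the matrix with rows
x_1, ..., x_n. Hence V_K = (2^n / n!) |det A| / |K|, with both sides zero when
A is singular ([relative_volumeE]), and what has to be computed is E det(A)^2
and E det(A)^4 for a random matrix A whose rows are independent and uniform in
K = B_q^n.

Moments of a row. As K is invariant under sign changes of the coordinates, the
expectation of a monomial x^e vanishes as soon as one exponent is odd. For even
exponents, write exp(- N) as the integral of exp(- s) over s > N with
N = sum_i |x_i|^q. By homogeneity, the integral of x^e exp(- N(x)) over R^n is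
Gamma(1 + (n + |e|)/q) times the integral of x^e over K; it is also a product of
one-dimensional Gamma integrals ([integral_gauge], [integral_lq_ball]). For
q = +oo, K is a cube and the integral over K is directly a product. So the
moments of a row are those of independent coordinates with one-dimensional
moments rho(e), up to the factor
Gamma(1 + n/q) / Gamma(1 + (n + |e|)/q), which depends on the degree only
([expectation_monomial]).

Second moment. Expand det(A)^2 over pairs of permutations. By independence of
the rows ([indep_prod]) the expectation of a term is a product of second moments
of rows, which vanishes unless the two permutations agree; n! equal terms remain
([expectation_det2]).

Fourth moment. Expand det(A)^4 over quadruples of permutations; reordering the
rows makes the first one the identity and gives a factor n!. The moment of a
row in columns a, b, c, d is proportional to
  [a=b][c=d] + [a=c][b=d] + [a=d][b=c] + t [a=b=c=d],
where t = rho(4) / rho(2)^2 - 3 = A_q - 3: Wick's formula for a Gaussian vector,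
corrected on the diagonal ([prod_weight4]). Expanding the product of these sums
over the rows splits the rows into S0 (all columns equal) and S1, S2, S3 (one
part for each pairing). The triples of permutations compatible with such a
partition are the (s2 s3, s1 s3, s1 s2) with s_k a permutation of S_k; they all
have sign +1, and there are |S1|! |S2|! |S3|! of them ([sum_paired]). A partition
therefore contributes t^|S0| |S1|! |S2|! |S3|!. With k = |S0|, multinomial
coefficients cancel the factorials up to n! / k!, and there are C(n - k + 2, 2)
ways to choose the sizes of the other three parts, whence
n! sum_k t^k / k! C(n - k + 2, 2) ([sum_fourth_weight]); for n >= 2 this is
n! (n + 1)(n + 2) / 2 times phi(t, n) ([sum_exp_binom2]). *)

Set Implicit Arguments.
Unset Strict Implicit.
Unset Printing Implicit Defensive.

Local Open Scope ring_scope.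

(** * Even powers of a determinant and pairings of permutations *)

Section subset_sums.
Variables (R : comNzRingType) (T : finType).

(** Distributivity, indexed by the set of the positions where the first summand is chosen. *)
Lemma prodD_subset (A : {set T}) (F G : T -> R) :
  \prod_(i in A) (F i + G i) =
  \sum_(B : {set T} | B \subset A) (\prod_(i in B) F i) * \prod_(i in A :\: B) G i.
Proof.
pose H i (b : bool) := if i \in A then if b then F i else G i else (~~ b)%:R.
transitivity (\prod_i \sum_(b : bool) H i b).
  rewrite big_mkcond /=; apply: eq_bigr => i _; rewrite big_bool /H /=.
  by case: ifP => // _; rewrite add0r.
rewrite bigA_distr_bigA /=.
rewrite (reindex (fun B : {set T} => [ffun i => i \in B])) /=; last first.
  exists (fun f : {ffun T -> bool} => [set i | f i]) => [B|f] _.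
    by apply/finset.setP => i; rewrite !inE ffunE.
  by apply/ffunP => i; rewrite !ffunE inE.
rewrite [RHS]big_mkcond /=; apply: eq_bigr => B _; case: ifPn => [BA|/subsetPn[i iB iA]].
  rewrite [X in X * _]big_mkcond [X in _ * X]big_mkcond -big_split /=.
  apply: eq_bigr => i _; rewrite ffunE /H inE.
  have /implyP := fintype.subsetP BA i.
  by case: (i \in B); case: (i \in A) => //= _; rewrite ?mulr1 ?mul1r.
by rewrite (bigD1 i)//= ffunE /H (negbTE iA) iB mul0r.
Qed.

Lemma sum_subset_card (A : {set T}) (u v : nat -> R) :
  \sum_(B : {set T} | B \subset A) u #|B| * v #|A :\: B| =
  \sum_(k < #|A|.+1) 'C(#|A|, k)%:R * (u k * v (#|A| - k)%N).
Proof.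
(* group the subsets by cardinality *)
pose f (B : {set T}) : 'I_(#|A|.+1) := inord #|B|.
rewrite (partition_big f predT)//=; apply: eq_bigr => k _.
rewrite (eq_bigr (fun _ => u k * v (#|A| - k)%N)); last first.
  move=> B /andP[BA /eqP fB]; have -> : #|A :\: B| = (#|A| - k)%N.
    by rewrite cardsD (finset.setIidPr BA) -fB inordK// ltnS subset_leq_card.
  by rewrite -fB inordK// ltnS subset_leq_card.
rewrite (eq_bigl (fun B => B \in [set B : {set T} | (B \subset A) && (#|B| == k)])).
  by rewrite sumr_const cards_draws mulr_natl.
move=> B; rewrite inE; case BA: (B \subset A) => //=.
by rewrite -val_eqE /= inordK// ltnS subset_leq_card.
Qed.

End subset_sums.

Section pairing_permutations.
Variable T : finType.
Implicit Types (S : {set T}) (p s : {perm T} * {perm T} * {perm T}).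

(** The compatibility of three permutations, together with the identity as a
fourth one, with a partition of the indices: on S0 all four agree, and on S1, S2,
S3 they agree two by two, according to the three pairings of {0, 1, 2, 3}. *)
Definition paired S0 S1 S2 S3 p :=
  [forall i, [&& (i \in S0) ==> [&& p.1.1 i == i, p.1.2 i == i & p.2 i == i],
                 (i \in S1) ==> (p.1.1 i == i) && (p.1.2 i == p.2 i),
                 (i \in S2) ==> (p.1.2 i == i) && (p.1.1 i == p.2 i) &
                 (i \in S3) ==> (p.2 i == i) && (p.1.1 i == p.1.2 i)]].

(** If s_k is a permutation of S_k, then on S_k the k-th of these three
permutations is the identity and the other two are equal to s_k. *)
Definition pair_perms s := (s.1.2 * s.2, s.1.1 * s.2, s.1.1 * s.1.2)%g.

(** The inverse of [pair_perms], read off from a permutation that moves the part. *)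
Definition unpair_perms S1 S2 S3 p :=
  (restr_perm S1 p.1.2, restr_perm S2 p.1.1, restr_perm S3 p.1.1).

Lemma restr_perm_eq S (s : {perm T}) (p : {perm T}) :
  perm_on S s -> {in S, p =1 s} -> restr_perm S p = s.
Proof.
move=> sS ps; apply/permP => i; have [iS|iS] := boolP (i \in S).
  rewrite restr_permE ?ps// inE; apply/andP; split; first by rewrite inE.
  by rewrite inE; apply/fintype.subsetP => j jS; rewrite inE /= /aperm ps// perm_closed.
by rewrite !(out_perm _ iS)// restr_perm_on.
Qed.

Lemma stab_restr_perm S (p : {perm T}) : {in S, forall i, p i \in S} ->
  {in S, restr_perm S p =1 p}.
Proof.
move=> pS i iS; rewrite restr_permE// inE; apply/andP; split; first by rewrite inE.
by rewrite inE; apply/fintype.subsetP => j jS; rewrite inE /= /aperm pS.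
Qed.

Variables (S0 S1 S2 S3 : {set T}).
Hypothesis part : forall i, ((i \in S0) + (i \in S1) + (i \in S2) + (i \in S3) = 1)%N.

Lemma S1_disjoint i : i \in S1 -> (i \in S2 = false) /\ (i \in S3 = false).
Proof.
by have := part i; case: (i \in S0); case: (i \in S1); case: (i \in S2); case: (i \in S3).
Qed.

Lemma S2_disjoint i : i \in S2 -> (i \in S1 = false) /\ (i \in S3 = false).
Proof.
by have := part i; case: (i \in S0); case: (i \in S1); case: (i \in S2); case: (i \in S3).
Qed.

Lemma S3_disjoint i : i \in S3 -> (i \in S1 = false) /\ (i \in S2 = false).
Proof.
by have := part i; case: (i \in S0); case: (i \in S1); case: (i \in S2); case: (i \in S3).
Qed.

(** A point of S1 cannot be sent by p.1.2 into a part where p.1.2 is the identity,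
by injectivity; nor into S3, where p.2 is the identity, since p.1.2 and p.2 agree
at the starting point. The other two parts are symmetric. *)
Lemma paired_stable p : paired S0 S1 S2 S3 p ->
  [/\ {in S1, forall i, p.1.2 i \in S1}, {in S2, forall i, p.1.1 i \in S2} &
      {in S3, forall i, p.1.1 i \in S3}].
Proof.
case: p => -[a b] c /forallP /= P.
have fix_out (q : {perm T}) i : q (q i) = q i -> q i = i by move/perm_inj.
split=> i iS.
- have := P i; rewrite iS /= => /and4P[_ /andP[/eqP ai /eqP bc] _ _].
  have := part (b i); have := part i.
  case b1: (b i \in S1) => //; case b0: (b i \in S0) => //=.
    by have := P (b i); rewrite b0 /= => /and4P[/and3P[_ /eqP/fix_out E _] _ _ _]; rewrite E iS in b1.
  case b2: (b i \in S2) => //=.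
    by have := P (b i); rewrite b2 /= => /and4P[_ _ /andP[/eqP/fix_out E _] _]; rewrite E iS in b1.
  case b3: (b i \in S3) => //= _ _.
  have := P (b i); rewrite b3 /= => /and4P[_ _ _ /andP[/eqP E _]].
  by move: E; rewrite {2}bc => /perm_inj E; rewrite E iS in b1.
- have := P i; rewrite iS /= => /and4P[_ _ /andP[/eqP bi /eqP ac] _].
  have := part (a i); have := part i.
  case a2: (a i \in S2) => //; case a0: (a i \in S0) => //=.
    by have := P (a i); rewrite a0 /= => /and4P[/and3P[/eqP/fix_out E _ _] _ _ _]; rewrite E iS in a2.
  case a1: (a i \in S1) => //=.
    by have := P (a i); rewrite a1 /= => /and4P[_ /andP[/eqP/fix_out E _] _ _]; rewrite E iS in a2.
  case a3: (a i \in S3) => //= _ _.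
  have := P (a i); rewrite a3 /= => /and4P[_ _ _ /andP[/eqP E _]].
  by move: E; rewrite {2}ac => /perm_inj E; rewrite E iS in a2.
- have := P i; rewrite iS /= => /and4P[_ _ _ /andP[/eqP ci /eqP ab]].
  have := part (a i); have := part i.
  case a3: (a i \in S3) => //; case a0: (a i \in S0) => //=.
    by have := P (a i); rewrite a0 /= => /and4P[/and3P[/eqP/fix_out E _ _] _ _ _]; rewrite E iS in a3.
  case a1: (a i \in S1) => //=.
    by have := P (a i); rewrite a1 /= => /and4P[_ /andP[/eqP/fix_out E _] _ _]; rewrite E iS in a3.
  case a2: (a i \in S2) => //= _ _.
  have := P (a i); rewrite a2 /= => /and4P[_ _ /andP[/eqP E _] _].
  by move: E; rewrite {2}ab => /perm_inj E; rewrite E iS in a3.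
Qed.

Lemma unpair_permsK p : paired S0 S1 S2 S3 p ->
  pair_perms (unpair_perms S1 S2 S3 p) = p.
Proof.
move=> Pp; have [st1 st2 st3] := paired_stable Pp.
case: p Pp st1 st2 st3 => -[a b] c /forallP /= P st1 st2 st3.
rewrite /pair_perms /unpair_perms /=.
have o S q i : i \notin S -> restr_perm S q i = i.
  by move=> iS; rewrite (out_perm (restr_perm_on S q) iS).
have r1 := stab_restr_perm st1; have r2 := stab_restr_perm st2.
have r3 := stab_restr_perm st3.
congr (_, _, _); apply/permP => i; rewrite permM;
  have := P i; have := part i;
  case i0: (i \in S0); case i1: (i \in S1); case i2: (i \in S2); case i3: (i \in S3) => //= _.
- by rewrite andbT => /and3P[/eqP ai _ _]; rewrite !o ?i2 ?i3 ?ai.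
- by rewrite andbT => /andP[/eqP ai _]; rewrite !o ?i2 ?i3 ?ai.
- by move=> _; have [_ a3] := S2_disjoint (st2 i i2); rewrite r2// o ?a3.
- by move=> _; rewrite (o S2) ?i2// r3.
- by rewrite andbT => /and3P[_ /eqP ai _]; rewrite !o ?i1 ?i3 ?ai.
- by move=> _; have [_ b3] := S1_disjoint (st1 i i1); rewrite r1// o ?b3.
- by rewrite andbT => /andP[/eqP ai _]; rewrite !o ?i1 ?i3 ?ai.
- by move=> /andP[_ /eqP ab]; rewrite (o S1) ?i1// r3.
- by rewrite andbT => /and3P[_ _ /eqP ai]; rewrite !o ?i1 ?i2 ?ai.
- rewrite andbT => /andP[_ /eqP bc]; have [b2 _] := S1_disjoint (st1 i i1).
  by rewrite r1// o ?b2.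
- by rewrite andbT => /andP[_ /eqP bc]; rewrite (o S1) ?i1// r2.
- by move=> /andP[/eqP ai _]; rewrite !o ?i1 ?i2 ?ai.
Qed.

Lemma pair_permsP s :
  paired S0 S1 S2 S3 (pair_perms s) && (unpair_perms S1 S2 S3 (pair_perms s) == s) =
  [&& perm_on S1 s.1.1, perm_on S2 s.1.2 & perm_on S3 s.2].
Proof.
case: s => -[a b] c /=; apply/andP/and3P => [[_ /eqP]|[a1 b2 c3]].
  by rewrite /unpair_perms => -[<- <- <-]; split; exact: restr_perm_on.
have o S q i : perm_on S q -> (i \in S) = false -> q i = i.
  by move=> qS /negbT iS; exact: (out_perm qS iS).
have cl S q i : perm_on S q -> (q i \in S) = (i \in S) by move=> qS; exact: perm_closed.
split.
  apply/forallP => i; rewrite /pair_perms /= !permM.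
  have := part i;
    case i0: (i \in S0); case i1: (i \in S1); case i2: (i \in S2); case i3: (i \in S3) => //= _.
  - by rewrite !(o S1 a)// !(o S2 b)// !(o S3 c)// !eqxx.
  - rewrite (o S2 b i)// (o S3 c i)// eqxx /=.
    have [a2 a3] : (a i \in S2 = false) /\ (a i \in S3 = false).
      by apply: S1_disjoint; rewrite (cl S1 a).
    by rewrite (o S2 b)// (o S3 c)// eqxx.
  - rewrite (o S1 a i)// (o S3 c i)// eqxx /=.
    have [_ b3] : (b i \in S1 = false) /\ (b i \in S3 = false).
      by apply: S2_disjoint; rewrite (cl S2 b).
    by rewrite (o S3 c)// eqxx.
  - by rewrite !(o S1 a i)// !(o S2 b i)// !eqxx.
rewrite /unpair_perms /pair_perms /=; apply/eqP; congr (_, _, _); apply: restr_perm_eq => // i iS;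
  rewrite permM.
- by rewrite (o S3 c)//; have [] : _ /\ _ := S1_disjoint (etrans (cl _ _ i a1) iS).
- by rewrite (o S3 c)//; have [] : _ /\ _ := S2_disjoint (etrans (cl _ _ i b2) iS).
- by rewrite (o S2 b i)//; have [] := S3_disjoint iS.
Qed.

(** In a product of signs over (s2 s3, s1 s3, s1 s2) each s_k occurs twice, so
the sum counts the compatible triples. *)
Lemma sum_paired (R : comNzRingType) :
  \sum_(p | paired S0 S1 S2 S3 p) (-1) ^+ (p.1.1 (+) p.1.2 (+) p.2) =
  (#|S1| `! * #|S2| `! * #|S3| `!)%:R :> R.
Proof.
rewrite (reindex_onto pair_perms (unpair_perms S1 S2 S3)) /=; last first.
  by move=> p; exact: unpair_permsK.
rewrite (eq_bigl _ _ pair_permsP) (eq_bigr (fun=> 1)); last first.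
  move=> [[a b] c] _; rewrite /pair_perms /= !odd_permM.
  by case: (odd_perm a); case: (odd_perm b); case: (odd_perm c).
rewrite -!card_perm -!sum1_card !natrM !natr_sum.
rewrite big_distrlr /= pair_big big_distrlr /= pair_big /=.
by apply: eq_big => [[[a b] c]|[[a b] c] _] /=; rewrite ?mulr1// unfold_in andbA.
Qed.

End pairing_permutations.

Section det_powers.
Variables (R : comNzRingType) (n : nat) (A : 'M[R]_n).

Lemma det_sqr : \det A ^+ 2 =
  \sum_(p : 'S_n * 'S_n) (-1) ^+ (p.1 (+) p.2) * \prod_i (A i (p.1 i) * A i (p.2 i)).
Proof.
rewrite expr2 /determinant big_distrlr /= pair_big /=; apply: eq_bigr => -[s u] _ /=.
by rewrite signr_addb big_split /= mulrACA.
Qed.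

(** One of the four permutations is used to relabel the others, so that the row
that it sends i to serves as the reference column. *)
Lemma det_exp4 : \det A ^+ 4 =
  \sum_(s : 'S_n) \sum_(p : 'S_n * 'S_n * 'S_n) (-1) ^+ (p.1.1 (+) p.1.2 (+) p.2) *
    \prod_i (A i (s i) * A i (p.1.1 (s i)) * A i (p.1.2 (s i)) * A i (p.2 (s i))).
Proof.
rewrite exprS {1}/determinant mulr_suml; apply: eq_bigr => s _.
transitivity (((-1) ^+ s * \prod_i A i (s i)) *
   \sum_(p : 'S_n * 'S_n * 'S_n) (-1) ^+ (p.1.1 (+) p.1.2 (+) p.2) *
    \prod_i (A i (p.1.1 i) * A i (p.1.2 i) * A i (p.2 i))).
  congr (_ * _); rewrite exprSr det_sqr /determinant big_distrlr /= pair_big /=.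
  by apply: eq_bigr => -[[a b] c] _ /=; rewrite !signr_addb !big_split /= mulrACA.
rewrite (reindex (fun p : 'S_n * 'S_n * 'S_n => (s * p.1.1, s * p.1.2, s * p.2)%g)) /=; last first.
  exists (fun p : 'S_n * 'S_n * 'S_n => (s^-1 * p.1.1, s^-1 * p.1.2, s^-1 * p.2)%g);
  by move=> [[a b] c] _ /=; rewrite ?mulKg ?mulKVg.
rewrite mulr_sumr; apply: eq_bigr => -[[a b] c] _ /=.
rewrite mulrACA -signr_addb -big_split /= !odd_permM; congr (_ * _).
  by case: (odd_perm s); case: (odd_perm a); case: (odd_perm b); case: (odd_perm c).
by apply: eq_bigr => i _; rewrite !permM !mulrA.
Qed.

End det_powers.

Section fourth_moment.
Variable (R : numFieldType).

Lemma prod_natb (T : finType) (S : {set T}) (b : pred T) :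
  \prod_(i in S) (b i)%:R = [forall i in S, b i]%:R :> R.
Proof.
have [/forallP bS|] := boolP [forall i in S, b i].
  by rewrite big1// => i iS; have /implyP -> := bS i.
rewrite negb_forall => /existsP[i]; rewrite negb_imply => /andP[iS bi].
by rewrite (bigD1 i)//= (negbTE bi) mul0r.
Qed.

(** Wick's formula for the fourth moment of a standard Gaussian vector in the
coordinates a, b, c, d, plus t on the diagonal. The order of the terms is that of
the parts S0, S1, S2, S3 of [paired]. *)
Definition fourth_weight (t : R) (T : eqType) (a b c d : T) : R :=
  t * [&& b == a, c == a & d == a]%:R +
  (((b == a) && (c == d))%:R + (((c == a) && (b == d))%:R + ((d == a) && (b == c))%:R)).

Lemma sum_partition_fact m :
  \sum_(k < m.+1) 'C(m, k)%:R * (k`!%:R * (m - k)`!%:R) = (m.+1)`!%:R :> R.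
Proof.
rewrite (eq_bigr (fun=> m`!%:R)); last first.
  by move=> k _; rewrite -!natrM bin_fact// -ltnS.
by rewrite sumr_const card_ord -mulrnA mulnC -factS.
Qed.

(** A count of the triples of permutations of three sets partitioning m points:
k is the size of the first set, and (m - k + 1)! counts the pairs for the other
two, by [sum_partition_fact]. Each of the C(m + 2, 2) triples of sizes
contributes m!. *)
Lemma sum_partition_fact2 m :
  \sum_(k < m.+1) 'C(m, k)%:R * (k`!%:R * (m - k).+1`!%:R) =
  m`!%:R * 'C(m.+2, 2)%:R :> R.
Proof.
rewrite (eq_bigr (fun k : 'I_m.+1 => m`!%:R * (m - k).+1%:R)); last first.
  move=> k _; rewrite -!natrM factS; congr _%:R.
  have km : (k <= m)%N by rewrite -ltnS.
  by rewrite -(bin_fact km) -!mulnA; congr (_ * (_ * _))%N; rewrite mulnC.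
rewrite -mulr_sumr; congr (_ * _).
rewrite -natr_sum; congr _%:R.
rewrite (reindex_inj rev_ord_inj) /=.
rewrite (eq_bigr (fun k : 'I_m.+1 => k.+1)); last first.
  by move=> k _; rewrite subSS subKn// -ltnS.
rewrite -(big_mkord xpredT (fun k => k.+1)) /= -bin2_sum.
by rewrite [RHS]big_nat_recl//= add0n.
Qed.

Lemma sum_fourth_weight (t : R) n :
  \sum_(p : 'S_n * 'S_n * 'S_n) (-1) ^+ (p.1.1 (+) p.1.2 (+) p.2) *
    \prod_i fourth_weight t i (p.1.1 i) (p.1.2 i) (p.2 i) =
  n`!%:R * \sum_(k < n.+1) t ^+ k / k`!%:R * 'C((n - k).+2, 2)%:R.
Proof.
set T := 'I_n.
(* the four conditions of [paired], in the order of the summands of the weight *)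
pose F0 (p : 'S_n * 'S_n * 'S_n) (i : T) := [&& p.1.1 i == i, p.1.2 i == i & p.2 i == i].
pose F1 (p : 'S_n * 'S_n * 'S_n) (i : T) := (p.1.1 i == i) && (p.1.2 i == p.2 i).
pose F2 (p : 'S_n * 'S_n * 'S_n) (i : T) := (p.1.2 i == i) && (p.1.1 i == p.2 i).
pose F3 (p : 'S_n * 'S_n * 'S_n) (i : T) := (p.2 i == i) && (p.1.1 i == p.1.2 i).
transitivity (\sum_(S0 : {set T} | S0 \subset [set: T])
   \sum_(S1 : {set T} | S1 \subset [set: T] :\: S0)
   \sum_(S2 : {set T} | S2 \subset [set: T] :\: S0 :\: S1)
   \sum_(p : 'S_n * 'S_n * 'S_n) (-1) ^+ (p.1.1 (+) p.1.2 (+) p.2) *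
     ((\prod_(i in S0) (t * (F0 p i)%:R)) *
      ((\prod_(i in S1) (F1 p i)%:R) *
       ((\prod_(i in S2) (F2 p i)%:R) *
        \prod_(i in [set: T] :\: S0 :\: S1 :\: S2) (F3 p i)%:R)))).
  under [RHS]eq_bigr => S0 _ do under eq_bigr => S1 _ do rewrite exchange_big.
  under [RHS]eq_bigr => S0 _ do rewrite exchange_big.
  rewrite [RHS]exchange_big; apply: eq_bigr => p _ /=.
  rewrite (_ : \prod_i _ = \prod_(i in [set: T])
      fourth_weight t i (p.1.1 i) (p.1.2 i) (p.2 i)); last first.
    by apply: eq_bigl => i; rewrite inE.
  rewrite /fourth_weight prodD_subset mulr_sumr.
  apply: eq_bigr => S0 _; rewrite prodD_subset !mulr_sumr.
  apply: eq_bigr => S1 _; rewrite prodD_subset !mulr_sumr.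
  by apply: eq_bigr.
transitivity (\sum_(S0 : {set T} | S0 \subset [set: T])
   t ^+ #|S0| * \sum_(S1 : {set T} | S1 \subset [set: T] :\: S0)
   #|S1| `!%:R * \sum_(S2 : {set T} | S2 \subset [set: T] :\: S0 :\: S1)
     #|S2| `!%:R * #|[set: T] :\: S0 :\: S1 :\: S2| `!%:R).
  apply: eq_bigr => S0 _; rewrite mulr_sumr; apply: eq_bigr => S1 S10.
  rewrite !mulr_sumr; apply: eq_bigr => S2 S21.
  set S3 := _ :\: S2.
  have part i : ((i \in S0) + (i \in S1) + (i \in S2) + (i \in S3) = 1)%N.
    have /implyP := fintype.subsetP S10 i; have /implyP := fintype.subsetP S21 i.
    rewrite /S3 !inE !andbT.
    by case: (i \in S0); case: (i \in S1); case: (i \in S2).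
  rewrite -!natrM mulnA -(sum_paired part) mulr_sumr big_mkcond /=.
  rewrite [RHS]big_mkcond; apply: eq_bigr => p _.
  rewrite big_split /= prodr_const -!mulrA !prod_natb mulrCA -!natrM !mulnb.
  rewrite (_ : [&& _, _, _ & _] = paired S0 S1 S2 S3 p).
    by case: ifP => _; rewrite ?mulr1 ?mulr0.
  apply/and4P/forallP => [[/forallP h0 /forallP h1 /forallP h2 /forallP h3] i|h].
    by have := h0 i; have := h1 i; have := h2 i; have := h3 i; rewrite /F0 /F1 /F2 /F3 => -> -> -> ->.
  by split; apply/forallP => i; have /and4P[] := h i.
under eq_bigr => S0 _ do under eq_bigr => S1 _ do
  rewrite (sum_subset_card _ (fun k => k`!%:R) (fun k => k`!%:R)) sum_partition_fact.
under eq_bigr => S0 _ do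
  rewrite (sum_subset_card _ (fun k => k`!%:R) (fun k => k.+1`!%:R)) sum_partition_fact2.
rewrite (sum_subset_card _ (fun k => t ^+ k) (fun k => k`!%:R * 'C(k.+2, 2)%:R)).
rewrite cardsT card_ord mulr_sumr; apply: eq_bigr => k _.
have kn : (k <= n)%N by rewrite -ltnS.
rewrite -(bin_fact kn) !natrM.
have : k`!%:R != 0 :> R by rewrite pnatr_eq0 -lt0n fact_gt0.
by move=> k0; field.
Qed.

(** The binomial coefficient is a quadratic polynomial in k, hence a combination
of 1, k and k (k - 1). As k t^k / k! = t t^(k-1) / (k-1)!, these weights turn the sum
into exponential sums truncated at n, n - 1 and n - 2; completing the last two to
the first yields the boundary terms. *)
Lemma sum_exp_binom2 (t : R) n : (2 <= n)%N ->
  \sum_(k < n.+1) t ^+ k / k`!%:R * 'C((n - k).+2, 2)%:R =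
  n.+1%:R * n.+2%:R / 2 *
  ((1 - 2 * t / n.+2%:R + t ^+ 2 / (n.+1%:R * n.+2%:R)) *
    (\sum_(0 <= k < n.+1) t ^+ k / k`!%:R)
  + t ^+ n.+1 / n.+1`!%:R - t ^+ n.+2 / n.+2`!%:R).
Proof.
case: n => [|[|m]]// _.
pose a k := t ^+ k / k`!%:R; pose E m := \sum_(k < m) a k.
have aS k : k.+1%:R * a k.+1 = t * a k.
  rewrite /a exprS factS natrM.
  have : k`!%:R != 0 :> R by rewrite pnatr_eq0 -lt0n fact_gt0.
  have : k.+1%:R != 0 :> R by rewrite pnatr_eq0.
  by move: (k.+1%:R) (k`!%:R) => u v u0 v0; field; rewrite u0 v0.
have L1 p : \sum_(k < p.+1) k%:R * a k = t * E p.
  rewrite big_ord_recl /= mul0r add0r mulr_sumr; apply: eq_bigr => k _.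
  by rewrite /bump /= add1n aS.
have L2 p : \sum_(k < p.+2) k%:R * (k%:R - 1) * a k = t ^+ 2 * E p.
  rewrite big_ord_recl /= !mul0r add0r expr2 -mulrA -L1 mulr_sumr.
  apply: eq_bigr => k _; rewrite /bump /= add1n mulrAC aS.
  by rewrite -natr1 addrK -mulrA [a k * _]mulrC.
have -> : \sum_(0 <= k < m.+3) t ^+ k / k`!%:R = E m.+3 by rewrite big_mkord.
transitivity (\sum_(k < m.+3) ((m.+3%:R * m.+4%:R / 2) * a k - m.+3%:R * (k%:R * a k) +
    2^-1 * (k%:R * (k%:R - 1) * a k))).
  apply: eq_bigr => k _; rewrite -/(a k).
  have -> : 'C((m.+2 - k).+2, 2)%:R = ((m.+4 - k)%N%:R * (m.+3 - k)%N%:R) / 2 :> R.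
    have k3 : (k <= m.+2)%N by rewrite -ltnS.
    rewrite -!subSn ?(leq_trans k3)// bin2 /=.
    have -> : (m.+4 - k).-1 = (m.+3 - k)%N by lia.
    rewrite -natrM -[(_ * _)%N in RHS](odd_double_half) oddM.
    have -> : odd (m.+4 - k) && odd (m.+3 - k) = false.
      by rewrite [(m.+4 - k)%N]subSn ?(leq_trans k3)//= andNb.
    by rewrite add0n -mul2n natrM mulrAC divff ?mul1r// pnatr_eq0.
  have k3 : (k <= m.+3)%N by apply: ltnW.
  rewrite !natrB//; last exact: leq_trans k3 _.
  have -> : m.+4%:R = m.+3%:R + 1 :> R by rewrite -addn1 natrD.
  by move: (m.+3%:R) (k%:R) (a k) => x y z; field.
rewrite big_split sumrB /= -!mulr_sumr L1 L2 -/(E _).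
have E2 : E m.+3 = E m.+1 + a m.+1 + a m.+2 by rewrite /E 2!big_ord_recr.
have E1 : E m.+2 = E m.+1 + a m.+1 by rewrite /E big_ord_recr.
rewrite E2 E1 -/(a m.+3) -/(a m.+4).
have a2 : a m.+2 = t * a m.+1 / m.+2%:R by rewrite -aS mulrAC divff ?mul1r// pnatr_eq0.
have a3 : a m.+3 = t * a m.+2 / m.+3%:R by rewrite -aS mulrAC divff ?mul1r// pnatr_eq0.
have a4 : a m.+4 = t * a m.+3 / m.+4%:R by rewrite -aS mulrAC divff ?mul1r// pnatr_eq0.
rewrite a4 a3 a2.
have : m.+2%:R != 0 :> R by rewrite pnatr_eq0.
have : m.+3%:R != 0 :> R by rewrite pnatr_eq0.
have : m.+4%:R != 0 :> R by rewrite pnatr_eq0.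
have -> : m.+4%:R = m.+2%:R + 2 :> R by rewrite -addn2 natrD.
have -> : m.+3%:R = m.+2%:R + 1 :> R by rewrite -addn1 natrD.
move: (m.+2%:R) (E m.+1) (a m.+1) => x e b h4 h3 h2.
by field; rewrite h2 h3 h4.
Qed.

(** A column met only once contributes rho(1) = 0. *)
Lemma prod_weight2 (T : finType) (rho : nat -> R) (a b : T) :
  rho 0%N = 1 -> rho 1%N = 0 ->
  \prod_i rho ((i == a) + (i == b))%N = rho 2%N * (a == b)%:R.
Proof.
move=> r0 r1; have [->|ab] := eqVneq a b.
  rewrite mulr1 (bigD1 b)//= eqxx big1 ?mulr1// => i ib.
  by rewrite (negbTE ib).
by rewrite mulr0 (bigD1 a)//= eqxx (negbTE ab) r1 mul0r.
Qed.

(** The multiplicities of the columns among a, b, c, d form one of the patterns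
4, 2+2 or some pattern containing an odd number; the last kind contributes 0, the
second rho(2)^2, and on the diagonal the three pairings add up to 3, which
the correction replaces by rho(4) / rho(2)^2. *)
Lemma prod_weight4 (T : finType) (rho : nat -> R) (a b c d : T) :
  rho 0%N = 1 -> rho 1%N = 0 -> rho 2%N != 0 ->
  \prod_i rho ((i == a) + (i == b) + (i == c) + (i == d))%N =
  rho 2%N ^+ 2 * fourth_weight (rho 4%N / rho 2%N ^+ 2 - 3) a b c d.
Proof.
move=> r0 r1 r2.
have odd1 (i : T) (e : T -> nat) : e i = 1%N -> \prod_i rho (e i) = 0.
  by move=> ei; rewrite (bigD1 i)//= ei r1 mul0r.
have pair (x y : T) (e : T -> nat) : x != y ->
    (forall i, e i = (i == x) + (i == x) + ((i == y) + (i == y)))%N ->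
    \prod_i rho (e i) = rho 2%N ^+ 2.
  move=> xy eE; rewrite (bigD1 x)//= (bigD1 y)//= 1?eq_sym// big1.
    by rewrite !eE !eqxx (negbTE xy) [y == x]eq_sym (negbTE xy) mulr1 expr2.
  by move=> i /andP[ix iy]; rewrite eE (negbTE ix) (negbTE iy).
rewrite /fourth_weight.
have sym (x y : T) : x != y -> ((x == y) = false) * ((y == x) = false).
  by move=> /negbTE xy; rewrite [y == x]eq_sym xy.
have [->|ba] := eqVneq b a.
  have [->|ca] := eqVneq c a.
    have [->|da] := eqVneq d a.
      rewrite (bigD1 a)//= ?eqxx big1 ?mulr1; last by move=> i ia; rewrite (negbTE ia).
      by field.
    rewrite (odd1 d); last by rewrite ?eqxx ?(sym _ _ da).
    by rewrite /= !(andbF, mulr0, addr0, add0r).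
  have [->|cd] := eqVneq d c.
    rewrite (pair a c); [|by rewrite eq_sym|by move=> i; rewrite addnA].
    by rewrite ?(sym _ _ ca) ?eqxx /= !(mulr0, addr0, add0r, mulr1).
  rewrite (odd1 c); last by rewrite ?eqxx ?(sym _ _ ca) ?(sym _ _ cd).
  by rewrite ?(sym _ _ ca) ?(sym _ _ cd) /= !(andbF, mulr0, addr0, add0r).
have [->|ca] := eqVneq c a.
  have [->|db] := eqVneq d b.
    rewrite (pair a b); [|by rewrite eq_sym|by move=> i; lia].
    by rewrite ?(sym _ _ ba) ?eqxx /= !(mulr0, addr0, add0r, mulr1).
  rewrite (odd1 b); last by rewrite ?eqxx ?(sym _ _ ba) ?(sym _ _ db).
  by rewrite ?(sym _ _ ba) ?(sym _ _ db) /= !(andbF, mulr0, addr0, add0r).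
have [->|da] := eqVneq d a.
  have [->|cb] := eqVneq c b.
    rewrite (pair a b); [|by rewrite eq_sym|by move=> i; lia].
    by rewrite ?(sym _ _ ba) ?eqxx /= !(mulr0, addr0, add0r, mulr1).
  rewrite (odd1 b); last by rewrite ?eqxx ?(sym _ _ ba) ?(sym _ _ cb).
  by rewrite ?(sym _ _ ba) ?(sym _ _ cb) ?(sym _ _ ca) /= !(andbF, mulr0, addr0, add0r).
rewrite (odd1 a); last by rewrite ?eqxx ?(sym _ _ ba) ?(sym _ _ ca) ?(sym _ _ da).
by rewrite /= !(andbF, mulr0, addr0, add0r).
Qed.

End fourth_moment.

Local Open Scope classical_set_scope.

(** * Linear change of variables in R^n *)

(** Lets a pushforward be used as a measure when the measurability of the
function is a hypothesis instead of a canonical structure. *)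
Lemma pushforward_measure d d' (T : measurableType d) (T' : measurableType d')
    (R : realType) (m : {measure set T -> \bar R}) (f : T -> T') :
  measurable_fun setT f ->
  exists m' : {measure set T' -> \bar R}, forall B, m' B = m (f @^-1` B).
Proof.
move=> mf.
pose F : {mfun T >-> T'} := HB.pack f (isMeasurableFun.Build _ _ _ _ _ mf).
suff m' : Measure.axioms_ (pushforward m f) by exists (Measure.Pack m').
exact: (Measure.class _ : Measure.axioms_ (pushforward m F)).
Qed.

Lemma preimage_measurable d d' (T : measurableType d) (T' : measurableType d')
    (f : T -> T') (A : set T') :
  measurable_fun setT f -> measurable A -> measurable (f @^-1` A).
Proof. by move=> mf mA; rewrite -[X in measurable X]setTI; exact: mf. Qed.

Section affine1.
Context {R : realType}.
Let mu := @lebesgue_measure R.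

Lemma lebesgue_measure_translate (b : R) (A : set (measurableTypeR R)) :
  measurable A -> mu ((fun x => x + b) @^-1` A) = mu A.
Proof.
have mf : measurable_fun [set: measurableTypeR R] (fun x : measurableTypeR R => x + b : measurableTypeR R).
  exact: measurable_funD.
move=> mA; apply/esym.
have [m0 m0E] : exists m0 : {measure set (measurableTypeR R) -> \bar R},
    forall B, m0 B = mu ((fun x => x + b) @^-1` B).
  exact: pushforward_measure.
rewrite -m0E; apply: (@lebesgue_measure_unique R m0) => //.
move=> _ [[u v]] _ <- /=.
have -> : m0 `]u, v]%classic = mu `]u - b, v - b]%classic.
  rewrite m0E; congr (mu _); apply/seteqP; split => x /=;
  by rewrite !in_itv /= ltrBlDr lerBrDr.
by rewrite /mu !lebesgue_measure_itv /= !lte_fin ltrD2r -!EFinB; case: ifP => // _;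
  congr EFin; ring.
Qed.

Lemma lebesgue_measure_scale (c : R) (A : set (measurableTypeR R)) : 0 < c ->
  measurable A -> (c%:E * mu ((fun x => x * c)%R @^-1` A) = mu A)%E.
Proof.
move=> c0.
have mf : measurable_fun [set: measurableTypeR R] (fun x : measurableTypeR R => x * c : measurableTypeR R).
  exact: measurable_funM.
move=> mA; apply/esym.
have [m0 m0E] : exists m0 : {measure set (measurableTypeR R) -> \bar R},
    forall B, m0 B = mu ((fun x => x * c)%R @^-1` B).
  exact: pushforward_measure.
rewrite -m0E.
(* c times the image measure agrees with Lebesgue measure on intervals *)
pose m := mscale (NngNum (ltW c0)) m0.
transitivity (m A); last by [].
apply: (@lebesgue_measure_unique R m) => //.
move=> _ [[u v]] _ <- /=.
rewrite [RHS](_ : _ = (c%:E * mu `](u / c)%R, (v / c)%R]%classic)%E); last first.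
  rewrite /m /mscale /= m0E; congr (_ * mu _)%E; apply/seteqP; split => x /=;
  by rewrite !in_itv /= ltr_pdivrMr// ler_pdivlMr.
rewrite /mu !lebesgue_measure_itv /= !lte_fin ltr_pM2r ?invr_gt0// -!EFinB.
case: ifP => // _; last by rewrite mule0.
rewrite -EFinM -mulrBl; congr EFin; field; exact: lt0r_neq0.
Qed.

Lemma lebesgue_measure_scale_neq0 (c : R) (A : set (measurableTypeR R)) : c != 0 ->
  measurable A -> (`|c|%:E * mu ((fun x => x * c)%R @^-1` A) = mu A)%E.
Proof.
move=> c0 mA; have [cp|cn|/eqP] := ltgtP 0 c; last by rewrite eq_sym (negbTE c0).
  by rewrite gtr0_norm// lebesgue_measure_scale.
rewrite ltr0_norm//.
have mN : measurable (-%R @^-1` A).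
  by apply: preimage_measurable => //; exact: opprM.
apply: etrans (lebesgue_measureN mA).
apply: etrans (@lebesgue_measure_scale (- c) (-%R @^-1` A) _ mN); rewrite ?oppr_gt0//.
congr (_ * mu _)%E.
by apply/seteqP; split => x /=; rewrite mulrN opprK.
Qed.

End affine1.

Section rV_measurability.
Context {R : realType}.

Lemma measurable_sum_fun d (T : measurableType d) (I : Type) (s : seq I)
    (f : I -> T -> R) : (forall i, measurable_fun setT (f i)) ->
  measurable_fun setT (fun x => \sum_(i <- s) f i x).
Proof.
move=> mf; elim: s => [|i s IH].
  by under eq_fun do rewrite big_nil; exact: measurable_cst.
by under eq_fun do rewrite big_cons; exact: measurable_funD.
Qed.

Lemma measurable_prod_fun d (T : measurableType d) (I : Type) (s : seq I)
    (f : I -> T -> R) : (forall i, measurable_fun setT (f i)) ->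
  measurable_fun setT (fun x => \prod_(i <- s) f i x).
Proof.
move=> mf; elim: s => [|i s IH].
  by under eq_fun do rewrite big_nil; exact: measurable_cst.
by under eq_fun do rewrite big_cons; exact: measurable_funM.
Qed.

Lemma measurable_mulmxr m n (M : 'M[R]_(m, n)) :
  measurable_fun [set: 'rV[R]_m] (fun x : 'rV[R]_m => x *m M).
Proof.
apply: measurable_fun_rVP => i; under eq_fun do rewrite mxE.
apply: measurable_sum_fun => j.
by apply: measurable_funM => //; exact: measurable_coord.
Qed.

Lemma measurable_addr_rV n (b : 'rV[R]_n) :
  measurable_fun [set: 'rV[R]_n] (fun x : 'rV[R]_n => x + b).
Proof.
apply: measurable_fun_rVP => i; under eq_fun do rewrite mxE.
by apply: measurable_funD => //; exact: measurable_coord.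
Qed.

End rV_measurability.

Section linear_change.
Context {R : realType}.
Local Notation la n := (@lebesgue_rV R n).
Local Notation mu := (@lebesgue_measure R).

Lemma lebesgue_rVSl n (A : set 'rV[R]_n.+1) : la n.+1 A =
  (\int[mu]_a la n [set x | A (cons_rV (a, x))])%E.
Proof.
rewrite /= /cons_lebesgue /pushforward /product_measure1 /=.
apply: eq_integral => a _ /=; congr (la n _).
by apply/seteqP; split => x /=; rewrite /xsection /= inE.
Qed.

(** The recursive definition of Lebesgue measure integrates the first coordinate
last; Tonelli gives the opposite order, in which shears along the first coordinate
act on the sections by translations. *)
Lemma lebesgue_rVSr n (A : set 'rV[R]_n.+1) : measurable A -> la n.+1 A =
  (\int[la n]_x mu [set a | A (cons_rV (a, x))])%E.
Proof.
move=> mA; have mB := preimage_measurable (@measurable_cons_rV R n) mA.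
have := indic_fubini_tonelli mu (la n) mB.
rewrite indic_fubini_tonelli_FE// indic_fubini_tonelli_GE// => E.
rewrite /= /cons_lebesgue /pushforward /product_measure1 E.
apply: eq_integral => a _ /=; congr (mu _).
by apply/seteqP; split => x /=; rewrite /ysection /= inE.
Qed.

Lemma measurable_sectionl n (A : set 'rV[R]_n.+1) a : measurable A ->
  measurable [set x : 'rV[R]_n | A (cons_rV (a, x))].
Proof.
move=> mA; have mB := preimage_measurable (@measurable_cons_rV R n) mA.
rewrite (_ : [set _ | _] = xsection (@cons_rV R n @^-1` A) a).
  exact: measurable_xsection.
by apply/seteqP; split => x /=; rewrite /xsection /= inE.
Qed.

Lemma measurable_sectionr n (A : set 'rV[R]_n.+1) x : measurable A ->
  measurable [set a : measurableTypeR R | A (cons_rV (a, x))].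
Proof.
move=> mA; have mB := preimage_measurable (@measurable_cons_rV R n) mA.
rewrite (_ : [set _ | _] = ysection (@cons_rV R n @^-1` A) x).
  exact: measurable_ysection.
by apply/seteqP; split => a /=; rewrite /ysection /= inE.
Qed.

Lemma cons_rVE n a (x : 'rV[R]_n) :
  cons_rV (a, x) = row_mx (a%:M : 'M[R]_1) x :> 'rV[R]_(1 + n).
Proof. by []. Qed.

Lemma cons_rVD n a b (x y : 'rV[R]_n) :
  cons_rV (a, x) + cons_rV (b, y) = cons_rV (a + b, x + y).
Proof. by rewrite !cons_rVE (@add_row_mx _ 1 1 n) -raddfD. Qed.

Lemma cons_rV_surj n (x : 'rV[R]_n.+1) : x = cons_rV (uncons_rV x).
Proof.
apply/rowP => i; case: (unliftP ord0 i) => [j|] ->.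
  by rewrite cons_rV_lift mxE.
by rewrite cons_rV0.
Qed.

Lemma lebesgue_rV_translate n (b : 'rV[R]_n) A : measurable A ->
  la n ((fun x => x + b) @^-1` A) = la n A.
Proof.
elim: n b A => [|n IHn] b A mA.
  by congr (la 0 _); apply/seteqP; split => x /=; rewrite (_ : x + b = x)//;
     apply/rowP; case.
rewrite (cons_rV_surj b); case: (uncons_rV b) => c d.
set T := (X in la _ (X @^-1` _)).
have mT : measurable (T @^-1` A) by apply: preimage_measurable => //; exact: measurable_addr_rV.
have mTd : measurable ((fun x => x + cons_rV (c, 0)) @^-1` A).
  by apply: preimage_measurable => //; exact: measurable_addr_rV.
transitivity (la n.+1 ((fun x => x + cons_rV (c, 0)) @^-1` A)).
  rewrite !lebesgue_rVSl; apply: eq_integral => a _.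
  rewrite -[RHS](IHn d); last exact: measurable_sectionl.
  by congr (la n _); apply/seteqP; split => x /=; rewrite /T !cons_rVD addr0.
rewrite !lebesgue_rVSr//; apply: eq_integral => x _.
rewrite -[RHS](@lebesgue_measure_translate _ c); last exact: measurable_sectionr.
by congr (mu _); apply/seteqP; split => a /=; rewrite cons_rVD addr0.
Qed.

(** The change of variables formula, on sets. *)
Definition scales_volume n (M : 'M[R]_n) := forall A, measurable A ->
  (`|\det M|%:E * la n ((fun x => x *m M)%R @^-1` A) = la n A)%E.

Lemma scales_volumeM n (M N : 'M[R]_n) :
  scales_volume M -> scales_volume N -> scales_volume (M *m N).
Proof.
move=> sM sN A mA; rewrite det_mulmx normrM mulrC EFinM -muleA.
rewrite -[RHS](sN _ mA) -(sM ((fun x => x *m N) @^-1` A)).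
  by congr (_ * (_ * la n _))%E; apply/seteqP; split => x /=; rewrite mulmxA.
by apply: preimage_measurable => //; exact: measurable_mulmxr.
Qed.

(** A shear translates the sections at a fixed first coordinate. *)
Lemma scales_volume_upper n (u : 'rV[R]_n) :
  scales_volume (block_mx 1%:M u 0 1%:M : 'M[R]_(1 + n)).
Proof.
move=> A mA; rewrite (@det_ublock _ 1 n) !det1 mulr1 normr1 mul1e.
rewrite !lebesgue_rVSl; apply: eq_integral => a _.
rewrite -[RHS](@lebesgue_rV_translate n (a *: u)); last exact: measurable_sectionl.
congr (la n _); apply/seteqP; split => x /=;
by rewrite !cons_rVE (@mul_row_block _ 1 1 n 1 n) !mulmx1 !mulmx0 addr0 mul_scalar_mx addrC.
Qed.

(** A shear translates the sections along the first coordinate. *)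
Lemma scales_volume_lower n (v : 'cV[R]_n) :
  scales_volume (block_mx 1%:M 0 v 1%:M : 'M[R]_(1 + n)).
Proof.
move=> A mA; rewrite (@det_lblock _ 1 n) !det1 mulr1 normr1 mul1e.
rewrite !lebesgue_rVSr//; last first.
  by apply: preimage_measurable => //; exact: measurable_mulmxr.
apply: eq_integral => x _.
rewrite -[RHS](@lebesgue_measure_translate _ ((x *m v) 0 0)); last exact: measurable_sectionr.
have E a : cons_rV (a, x) *m (block_mx 1%:M 0 v 1%:M : 'M[R]_(1 + n)) =
    cons_rV (a + (x *m v) 0 0, x).
  rewrite !cons_rVE (@mul_row_block _ 1 1 n 1 n) !mulmx1 !mulmx0 add0r.
  by rewrite {1}[x *m v]mx11_scalar -raddfD.
by congr (mu _); apply/seteqP; split => a /=; rewrite E.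
Qed.

Lemma scales_volume_diag n (a : R) (M : 'M[R]_n) : a != 0 -> \det M != 0 ->
  scales_volume M -> scales_volume (block_mx a%:M 0 0 M : 'M[R]_(1 + n)).
Proof.
move=> a0 M0 sM.
have -> : block_mx a%:M 0 0 M = (block_mx a%:M 0 0 1%:M : 'M[R]_(1 + n)) *m (block_mx 1%:M 0 0 M : 'M[R]_(1 + n)).
  by rewrite mulmx_block !mulmx1 !mul0mx !mulmx0 !mul1mx !addr0 add0r.
apply: scales_volumeM => A mA.
  rewrite (@det_lblock _ 1 n) det1 mulr1 det_scalar expr1.
  have mA' : measurable ((fun x => x *m (block_mx a%:M 0 0 1%:M : 'M[R]_(1 + n))) @^-1` A).
    by apply: preimage_measurable => //; exact: measurable_mulmxr.
  rewrite !lebesgue_rVSr// -ge0_integralZl//; last first.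
    rewrite (_ : (fun _ => _) = mu \o ysection (@cons_rV R n @^-1`
       ((fun x => x *m (block_mx a%:M 0 0 1%:M : 'M[R]_(1 + n))) @^-1` A))).
      apply: measurable_fun_ysection.
      exact: (preimage_measurable (@measurable_cons_rV R n) mA').
    by apply/funext => x /=; congr (mu _); apply/seteqP; split => b /=; rewrite /ysection /= inE.
  apply: eq_integral => x _.
  rewrite -[RHS](@lebesgue_measure_scale_neq0 _ a)//; last exact: measurable_sectionr.
  congr (_ * mu _)%E; apply/seteqP; split => b /=;
  by rewrite !cons_rVE (@mul_row_block _ 1 1 n 1 n) !mulmx1 !mulmx0 add0r addr0 -scalar_mxM.
rewrite (@det_lblock _ 1 n) det1 mul1r.
rewrite !lebesgue_rVSl -ge0_integralZl//; last first.
  rewrite (_ : (fun _ => _) = la n \o xsection (@cons_rV R n @^-1`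
       ((fun x => x *m (block_mx 1%:M 0 0 M : 'M[R]_(1 + n))) @^-1` A))).
    apply: measurable_fun_xsection.
    apply: (preimage_measurable (@measurable_cons_rV R n)).
    by apply: preimage_measurable => //; exact: measurable_mulmxr.
  by apply/funext => b /=; congr (la n _); apply/seteqP; split => x /=; rewrite /xsection /= inE.
apply: eq_integral => b _.
rewrite -[RHS]sM; last exact: measurable_sectionl.
congr (_ * la n _)%E; apply/seteqP; split => x /=;
by rewrite !cons_rVE (@mul_row_block _ 1 1 n 1 n) !mulmx1 !mulmx0 add0r addr0.
Qed.

(** Block Gaussian elimination: when the top left entry is nonzero, M is a
product of two shears and a block diagonal matrix, to which induction applies.
Otherwise some other entry of the first column is nonzero, and a shear that adds
its row to the first one leads back to the first case. *)
Lemma lebesgue_rV_linear n (M : 'M[R]_n) : \det M != 0 -> scales_volume M.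
Proof.
elim: n M => [|n IHn] M M0.
  move=> A mA; rewrite det_mx00 normr1 mul1e; congr (la 0 _).
  by apply/seteqP; split => x /=; rewrite (_ : x *m M = x)//; apply/rowP; case.
have base (N : 'M[R]_(1 + n)) : \det N != 0 -> ulsubmx N 0 0 != 0 -> scales_volume N.
  move=> N0 a0; set a := ulsubmx N 0 0 in a0.
  pose u := a^-1 *: ursubmx N; pose v := a^-1 *: dlsubmx N.
  (* the Schur complement of the entry a *)
  pose N' := drsubmx N - dlsubmx N *m u.
  have NE : N = (block_mx 1%:M 0 v 1%:M : 'M[R]_(1 + n)) *m
     ((block_mx a%:M 0 0 N' : 'M[R]_(1 + n)) *m (block_mx 1%:M u 0 1%:M : 'M[R]_(1 + n))).
    rewrite !(@mulmx_block _ 1 n 1 n 1 n) !mulmx1 !mul0mx !mulmx0 !mul1mx !addr0 !add0r.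
    rewrite -[LHS](@submxK _ 1 n 1 n); congr (@block_mx _ 1 n 1 n _ _ _ _).
    - by rewrite [LHS]mx11_scalar.
    - by rewrite mul_scalar_mx scalerA divff// scale1r.
    - by rewrite mul_mx_scalar scalerA divff// scale1r.
    - rewrite mul_scalar_mx scalerA divff// scale1r /N' /u /v.
      by rewrite -scalemxAl -scalemxAr addrC subrK.
  have N'0 : \det N' != 0.
    move: N0; rewrite NE !det_mulmx (@det_lblock _ 1 n) (@det_lblock _ 1 n) (@det_ublock _ 1 n) !det1.
    by rewrite !mulr1 mul1r det_scalar mulf_eq0 negb_or => /andP[].
  rewrite NE; apply: scales_volumeM; first exact: scales_volume_lower.
  apply: scales_volumeM; last exact: scales_volume_upper.
  by apply: scales_volume_diag => //; exact: IHn.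
have [a0|a0] := eqVneq (@ulsubmx _ 1 n 1 n M 0 0) 0; last exact: base.
have [v0|/eqP v0] := pselect (@dlsubmx _ 1 n 1 n M = 0).
  move: M0; rewrite -[M](@submxK _ 1 n 1 n) v0 (@det_ublock _ 1 n).
  by rewrite [ulsubmx _]mx11_scalar a0 det_scalar expr1 mul0r eqxx.
have [i vi0] : exists i, @dlsubmx _ 1 n 1 n M i 0 != 0.
  apply/existsP; apply: contraNT v0; rewrite negb_exists => /forallP v0.
  by apply/eqP/matrixP => i j; rewrite ord1 [in RHS]mxE; apply/eqP; have := v0 i; rewrite negbK.
pose w : 'rV[R]_n := delta_mx 0 i.
pose S (e : 'rV[R]_n) : 'M[R]_(1 + n) := block_mx 1%:M e 0 1%:M.
have -> : M = S (- w) *m (S w *m M).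
  rewrite mulmxA /S (@mulmx_block _ 1 n 1 n 1 n) !mulmx1 !mul0mx !mulmx0 !mul1mx !addr0 !add0r subrr.
  by rewrite -scalar_mx_block mul1mx.
have dS e : \det (S e) = 1 by rewrite /S (@det_ublock _ 1 n) !det1 mulr1.
apply: scales_volumeM; first exact: scales_volume_upper.
apply: base; first by rewrite det_mulmx dS mul1r.
rewrite -[M](@submxK _ 1 n 1 n) /S (@mulmx_block _ 1 n 1 n 1 n) (@block_mxKul _ 1 n 1 n).
by rewrite !mul1mx mxE a0 add0r -rowE mxE.
Qed.

End linear_change.

(** * Exponential integrals and the Gamma function *)

Section one_dim.
Context {R : realType}.
Local Notation mu := (@lebesgue_measure R).

Lemma continuous_expRN : continuous (fun x : R => expR (- x)).
Proof.
by move=> x; apply: (@continuous_comp _ _ _ -%R expR);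
  [exact: opp_continuous|exact: continuous_expR].
Qed.

Lemma exprn_expRN_cvg0 n : x ^+ n * expR (- x) @[x --> +oo] --> (0 : R).
Proof.
apply/cvgrPdist_le => e e0; near=> x.
have x0 : 0 < x by near: x; apply: nbhs_pinfty_gt; exact: num_real.
rewrite sub0r normrN ger0_norm ?mulr_ge0 ?exprn_ge0 ?expR_ge0 ?(ltW x0)//.
have := expR_ge1Dxn n (ltW x0); set k := n.+1`!%:R => H.
have k0 : 0 < k :> R by rewrite ltr0n fact_gt0.
(* one more power of x than needed, so that the quotient is at most k / x *)
have H' : x ^+ n.+1 <= k * expR x.
  rewrite mulrC -ler_pdivrMr//; apply: le_trans H; by rewrite lerDr.
rewrite expRN ler_pdivrMr ?expR_gt0//.
rewrite -(ler_pM2l x0) -exprS (le_trans H')// mulrA ler_pM2r ?expR_gt0//.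
rewrite -ler_pdivrMr//.
Unshelve. all: by end_near. Qed.

(** The polynomial n! sum_(k <= n) x^k / k!: minus its product with exp(- x) is a
primitive of x^n exp(- x). *)
Fixpoint exp_poly (n : nat) : {poly R} :=
  if n is n'.+1 then 'X^n + exp_poly n' *+ n else 1.

Lemma exp_polyB_deriv n : exp_poly n - (exp_poly n)^`() = 'X^n.
Proof.
elim: n => [|n IH]; first by rewrite derivC subr0 expr0.
rewrite [exp_poly _]/= derivD derivXn derivMn /= -IH mulrnBl.
by rewrite subrK addrK.
Qed.

Lemma exp_poly_horner0 n : (exp_poly n).[0] = n`!%:R.
Proof.
elim: n => [|n IH]; first by rewrite hornerC.
by rewrite [exp_poly _]/= hornerD hornerXn hornerMn IH expr0n add0r factS mulnC natrM mulr_natr.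
Qed.

Lemma exp_poly_cvg0 n : (exp_poly n).[x] * expR (- x) @[x --> +oo] --> (0 : R).
Proof.
elim: n => [|n IH].
  by under eq_fun do rewrite hornerC mul1r; exact: cvgr_expR.
have -> : (fun x => (exp_poly n.+1).[x] * expR (- x)) =
  (fun x => x ^+ n.+1 * expR (- x) + n.+1%:R * ((exp_poly n).[x] * expR (- x))).
  by apply/funext => x; rewrite [exp_poly _]/= hornerD hornerXn hornerMn mulrDl mulr_natl mulrnAl.
rewrite -[X in _ --> X]addr0 -[X in _ --> _ + X](mulr0 n.+1%:R).
by apply: cvgD; [exact: exprn_expRN_cvg0|apply: cvgMr].
Qed.

Lemma integral_exprn_expRN n (a : R) : 0 <= a ->
  (\int[mu]_(x in `[a, +oo[) (x ^+ n * expR (- x))%:E =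
   ((exp_poly n).[a] * expR (- a))%:E)%E.
Proof.
move=> a0.
have dE (x : R) : is_derive x 1 (fun x => - ((exp_poly n).[x] * expR (- x))) (x ^+ n * expR (- x)).
  have h := is_derive_poly (exp_poly n) x.
  have g : is_derive x (1 : R) (expR \o -%R) (- expR (- x)).
    apply: DeriveDef => //.
    rewrite -derive1E derive1_comp//.
    by rewrite derive1N// derive1_id mulrN1 derive1E derive_val.
  have := is_deriveN (is_deriveM h g).
  move=> /is_derive_eq; apply.
  rewrite /GRing.scale /= -[x ^+ n]hornerXn -exp_polyB_deriv hornerD hornerN. ring.
have cF : continuous (fun x => - ((exp_poly n).[x] * expR (- x))).
  by move=> x; apply/differentiable_continuous/derivable1_diffP; have [] := dE x.
rewrite (@ge0_continuous_FTC2y _ _ (fun x => - ((exp_poly n).[x] * expR (- x))) _ 0)//.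
- by rewrite sub0e -EFinN opprK.
- by move=> x ax; rewrite mulr_ge0 ?expR_ge0// exprn_ge0// (le_trans a0).
- apply: continuous_subspaceT => x; apply: cvgM; first exact: exprn_continuous.
  exact: continuous_expRN.
- by rewrite -oppr0; apply: cvgN; exact: exp_poly_cvg0.
- by apply: cvg_at_right_filter; exact: cF.
- by move=> x _; rewrite derive1E; have [_ ->] := dE x.
Qed.

(** The layer-cake formula for exp(- N), as an integral over the whole line so
that Tonelli applies to it. The factor 0 < s restricts the scaling argument to
positive s; when N = 0 it removes the null set {0}. *)
Lemma expRN_layer (N : R) : 0 <= N -> (expR (- N))%:E =
  (\int[mu]_s ((N <= s)%R%:R * (0 < s)%R%:R * expR (- s))%:E)%E.
Proof.
move=> N0; have := integral_exprn_expRN 0 N0.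
rewrite [exp_poly 0]/= hornerC mul1r => <-.
have me : measurable_fun setT (EFin \o (fun x : R => x ^+ 0 * expR (- x))).
  apply/measurable_EFinP; apply: measurable_funM => //.
  by apply: continuous_measurable_fun; exact: continuous_expRN.
have h : forall D : set R, D = [set x | N <= x /\ 0 < x] ->
   (\int[mu]_(x in D) (x ^+ 0 * expR (- x))%:E =
   \int[mu]_s ((N <= s)%R%:R * (0 < s)%R%:R * expR (- s))%:E)%E.
  move=> D DE; rewrite integral_mkcond; apply: eq_integral => x _.
  rewrite patchE expr0 mul1r; case: ifPn.
    by rewrite inE DE => -[/= -> ->]; rewrite !mul1r.
  rewrite notin_setE DE /= => /not_andP[] /negP/negbTE ->; by rewrite ?mul0r ?mulr0 ?mul0r.
have [N0'|N0'] := ltP 0 N.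
  apply: h; apply/seteqP; split => x /=; rewrite in_itv /= andbT => //.
    by move=> Nx; split => //; exact: lt_le_trans Nx.
  by case.
have N00 : N = 0 by apply/eqP; rewrite eq_le N0 N0'.
have me0 : measurable_fun (`]0, +oo[%classic : set R) (fun x : R => (x ^+ 0 * expR (- x))%:E).
  by apply: measurable_funTS; exact: me.
rewrite {1}N00 -(integral_itv_obnd_cbnd me0).
apply: h; rewrite N00.
by apply/seteqP; split => x /=; rewrite in_itv /= andbT; [move=> x0; split => //; exact: ltW|case].
Qed.

(** The Gamma integral at u + 1, as an extended real: finiteness is a theorem,
whereas [Gamma] is real-valued by definition. *)
Definition gamma_integral (u : R) :=
  (\int[mu]_(x in `]0%R, +oo[) (x `^ u * expR (- x))%:E)%E.

Lemma measurable_gamma_integrand (u : R) D :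
  measurable_fun D (EFin \o (fun x : R => x `^ u * expR (- x))).
Proof.
apply/measurable_EFinP; apply: measurable_funM => //.
  by apply: measurable_funTS; exact: measurable_powR.
by apply: measurable_funTS; apply: continuous_measurable_fun; exact: continuous_expRN.
Qed.

Lemma gamma_integral_nat n : gamma_integral n%:R = (n`!%:R)%:E.
Proof.
have := integral_exprn_expRN n (lexx 0).
rewrite exp_poly_horner0 oppr0 expR0 mulr1 => <-.
rewrite -integral_itv_obnd_cbnd; last first.
  apply/measurable_EFinP; apply: measurable_funM => //.
  by apply: measurable_funTS; apply: continuous_measurable_fun; exact: continuous_expRN.
apply: eq_integral => x; rewrite inE /= in_itv /= andbT => x0.
by rewrite powR_mulrn// ltW.
Qed.

(** x^u is at most 1 + x^m for an integer m >= u. *)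
Lemma gamma_integral_fin u : 0 <= u -> (gamma_integral u < +oo)%E.
Proof.
move=> u0; pose m := Num.bound u.
apply: (@le_lt_trans _ _ (gamma_integral 0%:R + gamma_integral m%:R)%E); last first.
  by rewrite !gamma_integral_nat -EFinD ltry.
rewrite /gamma_integral -ge0_integralD//; last 4 first.
- by move=> x _; rewrite lee_fin mulr_ge0 ?powR_ge0 ?expR_ge0.
- exact: measurable_gamma_integrand.
- by move=> x _; rewrite lee_fin mulr_ge0 ?powR_ge0 ?expR_ge0.
- exact: measurable_gamma_integrand.
apply: ge0_le_integral => //.
- by move=> x _; rewrite lee_fin mulr_ge0 ?powR_ge0 ?expR_ge0.
- exact: measurable_gamma_integrand.
- by apply: emeasurable_funD; exact: measurable_gamma_integrand.
move=> x; rewrite /= in_itv /= andbT => x0.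
rewrite -EFinD lee_fin -mulrDl ler_pM2r ?expR_gt0//.
have [x1|x1] := leP x 1.
  apply: (@le_trans _ _ (x `^ 0)); first by apply: ger_powR => //; rewrite x0 x1.
  by rewrite lerDl powR_ge0.
apply: (@le_trans _ _ (x `^ m%:R)); last by rewrite lerDr powR_ge0.
apply: ler_powR; first exact: ltW.
by apply/ltW; apply: le_lt_trans (archi_boundP u0).
Qed.

Lemma gamma_integral_gt0 u : 0 <= u -> (0 < gamma_integral u)%E.
Proof.
move=> u0.
have : (\int[mu]_(x in `[1%R, 2%R]) (expR (- 2))%:E <= gamma_integral u)%E.
  apply: (@le_trans _ _ (\int[mu]_(x in `[1%R, 2%R]) (x `^ u * expR (- x))%:E)%E).
    apply: ge0_le_integral => //.
    - exact: measurable_gamma_integrand.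
    move=> x; rewrite /= in_itv /= => /andP[x1 x2].
    rewrite lee_fin -[leLHS]mul1r ler_pM ?expR_ge0//; last by rewrite ler_expR lerN2.
    by rewrite -(powRr0 x) ler_powR.
  apply: ge0_subset_integral => //.
  - exact: measurable_gamma_integrand.
  - by move=> x _; rewrite lee_fin mulr_ge0 ?powR_ge0 ?expR_ge0.
  by move=> x; rewrite /= !in_itv /= andbT => /andP[x1 _]; exact: lt_le_trans x1.
apply: lt_le_trans.
rewrite integral_cst//= lebesgue_measure_itv /= lte_fin.
by rewrite ltr1n -EFinB -EFinM lte_fin mulr_gt0 ?expR_gt0//; lra.
Qed.

Lemma GammaE u : 0 <= u -> (Gamma (1 + u))%:E = gamma_integral u.
Proof.
move=> u0; rewrite /Gamma /Rintegral fineK.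
  by rewrite /gamma_integral; apply: eq_integral => x _; rewrite addrAC subrr add0r.
rewrite ge0_fin_numE; last by apply: integral_ge0 => x _; rewrite lee_fin mulr_ge0 ?powR_ge0 ?expR_ge0.
by rewrite addrAC subrr add0r; exact: gamma_integral_fin.
Qed.

Lemma Gamma_gt0 (u : R) : 0 <= u -> 0 < Gamma (1 + u).
Proof. by move=> u0; rewrite -lte_fin GammaE// gamma_integral_gt0. Qed.

Lemma Gamma_nat n : Gamma (1 + n%:R : R) = n`!%:R.
Proof. by apply: EFin_inj; rewrite GammaE// gamma_integral_nat. Qed.

Lemma integral_even_power e : ~~ odd e ->
  (\int[mu]_x ((`|x| <= 1)%R%:R * x ^+ e)%:E = (2 / e.+1%:R)%:E)%E.
Proof.
move=> ee.
transitivity (\int[mu]_(x in `[(-1)%R, 1%R]) (x ^+ e)%:E)%E.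
  rewrite [RHS]integral_mkcond; apply: eq_integral => x _.
  rewrite patchE mem_setE in_itv /= ler_norml; case: ifP => _; by rewrite ?mul1r ?mul0r.
have dE (x : R) : is_derive x 1 (fun x : R => e.+1%:R^-1 * x ^+ e.+1) (x ^+ e).
  have := is_deriveZ e.+1%:R^-1 (is_deriveX e.+1 (is_derive_id x (1 : R))).
  rewrite (_ : (fun x : R => e.+1%:R^-1 * x ^+ e.+1) = e.+1%:R^-1 \*: id ^+ e.+1); last first.
    by apply/funext => y; rewrite /= exprfctE.
  by move=> /is_derive_eq; apply; rewrite /GRing.scale /= mulr1 mulrA mulVf ?mul1r// pnatr_eq0.
have cF : continuous (fun x : R => e.+1%:R^-1 * x ^+ e.+1).
  by move=> x; apply/differentiable_continuous/derivable1_diffP; have [] := dE x.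
rewrite (@continuous_FTC2 _ _ (fun x : R => e.+1%:R^-1 * x ^+ e.+1)).
- rewrite -EFinB -signr_odd /= ee expr1 expr1n; congr EFin; ring.
- lra.
- by apply: continuous_subspaceT => x; exact: exprn_continuous.
- split.
  + by move=> x _; have [] := dE x.
  + by apply: cvg_at_right_filter; exact: cF.
  + by apply: cvg_at_left_filter; exact: cF.
- by move=> x _; rewrite derive1E; have [_ ->] := dE x.
Qed.

End one_dim.

(** * Integration over R^n and layers of a gauge *)

Section rV_integral.
Context {R : realType}.
Local Notation la n := (@lebesgue_rV R n).
Local Notation mu := (@lebesgue_measure R).

Lemma measurable_ler_natr d (T : measurableType d) (u v : T -> R) :
  measurable_fun setT u -> measurable_fun setT v ->
  measurable_fun setT (fun x => (u x <= v x)%R%:R : R).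
Proof.
move=> mu_ mv; rewrite (_ : (fun _ => _) = (fun x => if (u x <= v x)%R then 1 else 0)).
  by apply: measurable_fun_ifT => //; exact: measurable_fun_ler.
by apply/funext => x; case: ifP.
Qed.

Lemma measurable_ltr_natr d (T : measurableType d) (u v : T -> R) :
  measurable_fun setT u -> measurable_fun setT v ->
  measurable_fun setT (fun x => (u x < v x)%R%:R : R).
Proof.
move=> mu_ mv; rewrite (_ : (fun _ => _) = (fun x => if (u x < v x)%R then 1 else 0)).
  by apply: measurable_fun_ifT => //; exact: measurable_fun_ltr.
by apply/funext => x; case: ifP.
Qed.

Lemma integral_rV0 (f : 'rV[R]_0 -> \bar R) : measurable_fun setT f ->
  (\int[la 0]_x f x = f 0%R)%E.
Proof. by move=> mf; rewrite /= integral_dirac// diracT mul1e. Qed.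

Lemma integral_rVS n (f : 'rV[R]_n.+1 -> \bar R) : measurable_fun setT f ->
  (forall x, 0 <= f x)%E ->
  (\int[la n.+1]_x f x = \int[mu]_a \int[la n]_x f (cons_rV (a, x)))%E.
Proof.
move=> mf f0.
rewrite (@ge0_integral_pushforward _ _ _ _ _ _ (@measurable_cons_rV R n) (mu \x la n)%E setT)//.
rewrite preimage_setT fubini_tonelli1//.
  exact: measurableT_comp mf (@measurable_cons_rV R n).
by move=> x; exact: f0.
Qed.

Lemma integral_rV_prod n (g : 'I_n -> R -> R) :
  (forall i, measurable_fun setT (g i)) -> (forall i t, 0 <= g i t) ->
  (\int[la n]_x (\prod_i g i (x ord0 i))%:E = \prod_i \int[mu]_t (g i t)%:E)%E.
Proof.
elim: n g => [|n IHn] g mg g0.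
  rewrite integral_rV0 ?big_ord0//.
  by under eq_fun do rewrite big_ord0; exact: measurable_cst.
have mG m (h : 'I_m -> R -> R) : (forall i, measurable_fun setT (h i)) ->
   measurable_fun setT (fun x : 'rV[R]_m => (\prod_i h i (x ord0 i))%:E).
  move=> mh; apply/measurable_EFinP; apply: measurable_prod_fun => i.
  exact: measurableT_comp (mh i) (@measurable_coord R m i).
rewrite integral_rVS//; last 2 first.
- exact: mG.
- by move=> x; rewrite lee_fin prodr_ge0.
rewrite big_ord_recl.
transitivity (\int[mu]_a ((g ord0 a)%:E * \prod_(i < n) \int[mu]_t (g (lift ord0 i) t)%:E)%E)%E.
  apply: eq_integral => a _; rewrite -IHn//.
  rewrite -ge0_integralZl//; last 3 first.
  - exact: (mG n (fun i => g (lift ord0 i))).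
  - by move=> x _; rewrite lee_fin prodr_ge0.
  - by rewrite lee_fin.
  apply: eq_integral => x _; rewrite -EFinM big_ord_recl cons_rV0.
  by congr (_ * _)%:E; apply: eq_bigr => i _; rewrite cons_rV_lift.
rewrite ge0_integralZr//.
- by apply/measurable_EFinP; exact: mg.
- by move=> x _; rewrite lee_fin.
- by apply: prode_ge0 => i _; apply: integral_ge0 => t _; rewrite lee_fin.
Qed.

Lemma integral_rV_linear n (M : 'M[R]_n) (f : 'rV[R]_n -> \bar R) :
  \det M != 0 -> measurable_fun setT f -> (forall x, 0 <= f x)%E ->
  (`|\det M|%:E * \int[la n]_x f (x *m M)%R = \int[la n]_x f x)%E.
Proof.
move=> M0 mf f0.
have [m mE] := @pushforward_measure _ _ _ _ R (la n) _ (measurable_mulmxr M).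
have -> : (\int[la n]_x f (x *m M)%R = \int[m]_x f x)%E.
  transitivity (\int[pushforward (la n) (mulmx^~ M)]_x f x)%E.
    by rewrite (@ge0_integral_pushforward _ _ _ _ _ _ (measurable_mulmxr M))// preimage_setT.
  apply: eq_measure_integral; first exact: measurable_mulmxr.
  by move=> ? A mA _; rewrite mE.
rewrite -(@ge0_integral_mscale _ _ _ m setT _ (NngNum (normr_ge0 (\det M))))//.
apply: eq_measure_integral => A mA _ /=.
by rewrite -(lebesgue_rV_linear M0 mA) /mscale /= mE.
Qed.

(** With N(x) = sum_i |x_i|^r, Tonelli applied to [expRN_layer] gives an integral
over s > 0 of exp(- s) times the integral of f over the set N <= s. The dilation
x |-> s^(1/r) x maps N <= 1 onto that set, which yields the factor s^((n + k)/r). *)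
Lemma integral_gauge n (r : R) (k : nat) (f : 'rV[R]_n -> R) :
  0 < r -> measurable_fun setT f -> (forall x, 0 <= f x) ->
  (forall c x, 0 < c -> f (c *: x) = c ^+ k * f x) ->
  (\int[la n]_x (f x * expR (- \sum_i `|x ord0 i| `^ r))%:E =
   gamma_integral ((n + k)%:R / r) *
   \int[la n]_x (f x * (\sum_i `|x ord0 i| `^ r <= 1)%R%:R)%:E)%E.
Proof.
move=> r0 mf f0 fh; set N := fun x : 'rV[R]_n => \sum_i `|x ord0 i| `^ r.
have N0 x : 0 <= N x by apply: sumr_ge0 => i _; exact: powR_ge0.
have mN : measurable_fun setT N.
  apply: measurable_sum_fun => i.
  have := @measurable_powR R r; move/measurableT_comp; apply.
  by apply: measurableT_comp => //; exact: measurable_coord.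
pose F (z : 'rV[R]_n * measurableTypeR R) :=
  (f z.1 * (N z.1 <= z.2)%R%:R * ((0 < z.2)%R%:R * expR (- z.2)))%:E.
have mf1 : measurable_fun setT (fun x => f x * (N x <= 1)%R%:R).
  by apply: measurable_funM => //; exact: measurable_ler_natr.
have mfs s : measurable_fun setT (fun x => f x * (N x <= s)%R%:R).
  by apply: measurable_funM => //; exact: measurable_ler_natr.
have mexp : measurable_fun setT (fun s : measurableTypeR R => (0 < s)%R%:R * expR (- s)).
  apply: measurable_funM; first exact: measurable_ltr_natr.
  by apply: continuous_measurable_fun; exact: continuous_expRN.
have mF : measurable_fun setT F.
  apply/measurable_EFinP/measurable_funM; last exact: measurableT_comp mexp _.
  apply: measurable_funM; first exact: measurableT_comp mf _.
  apply: measurable_ler_natr; last exact: measurable_snd.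
  exact: measurableT_comp mN _.
have F0 z : (0 <= F z)%E.
  by rewrite lee_fin !mulr_ge0// expR_ge0.
transitivity (\int[la n]_x \int[mu]_s F (x, s))%E.
  apply: eq_integral => x _.
  rewrite (_ : (fun s => F (x, s)) = (fun s => (f x)%:E *
      ((N x <= s)%R%:R * (0 < s)%R%:R * expR (- s))%:E)%E); last first.
    by apply/funext => s; rewrite -EFinM /F /= !mulrA.
  rewrite ge0_integralZl//.
  - by rewrite -expRN_layer// EFinM.
  - apply/measurable_EFinP; rewrite (_ : (fun _ => _) =
      (fun s => (N x <= s)%R%:R * ((0 < s)%R%:R * expR (- s)))); last first.
      by apply/funext => s; rewrite mulrA.
    by apply: measurable_funM => //; exact: measurable_ler_natr.
  - by rewrite lee_fin.
rewrite (@fubini_tonelli _ _ _ _ _ (la n) mu F)//.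
pose I := (\int[la n]_x (f x * (N x <= 1)%R%:R)%:E)%E.
transitivity (gamma_integral ((n + k)%:R / r) * I)%E; last by [].
have I0 : (0 <= I)%E by apply: integral_ge0 => x _; rewrite lee_fin mulr_ge0.
rewrite muleC -ge0_integralZl//; last 2 first.
- exact: measurable_gamma_integrand.
- by move=> s _; rewrite lee_fin mulr_ge0 ?powR_ge0 ?expR_ge0.
rewrite [RHS]integral_mkcond; apply: eq_integral => s _.
rewrite patchE mem_setE in_itv /= andbT; case: ifPn => [s0|].
  rewrite /F /= s0 mul1r.
  under eq_integral do rewrite EFinM.
  rewrite ge0_integralZr//; last 2 first.
  - exact/measurable_EFinP.
  - by move=> x _; rewrite lee_fin mulr_ge0.
  rewrite [RHS]muleC EFinM [RHS]muleAC; congr (_ * _)%E.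
  (* the factor of the dilation that maps N <= 1 onto N <= s *)
  pose c := s `^ r^-1.
  have c0 : 0 < c by exact: powR_gt0.
  have dc : \det (c%:M : 'M[R]_n) != 0 by rewrite det_scalar expf_neq0// gt_eqF.
  rewrite -(integral_rV_linear dc); last 2 first.
  - exact/measurable_EFinP.
  - by move=> x; rewrite lee_fin mulr_ge0.
  rewrite det_scalar ger0_norm ?exprn_ge0 ?(ltW c0)//.
  rewrite (_ : s `^ _ = c ^+ n * c ^+ k); last first.
    by rewrite -exprD /c -powR_mulrn ?powR_ge0// -powRrM mulrC.
  rewrite EFinM -muleA; congr (_ * _)%E.
  rewrite /I -ge0_integralZl//; last 3 first.
  - exact/measurable_EFinP.
  - by move=> x _; rewrite lee_fin mulr_ge0.
  - by rewrite lee_fin exprn_ge0// ltW.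
  apply: eq_integral => x _; rewrite mul_mx_scalar fh// -EFinM mulrA.
  suff NE : N (c *: x) = s * N x by rewrite NE ger_pMr.
  rewrite /N mulr_sumr; apply: eq_bigr => i _; rewrite !mxE normrM powRM//.
  by rewrite (gtr0_norm c0) /c -powRrM mulVf ?gt_eqF// powRr1// ltW.
move=> /negbTE s0; rewrite integral0_eq// => x _.
by rewrite /F /= s0 mul0r mulr0.
Qed.

End rV_integral.

(** * Integrals of monomials over l_q balls *)

Section lq_ball.
Context {R : realType}.
Local Notation la n := (@lebesgue_rV R n).
Local Notation mu := (@lebesgue_measure R).

Lemma powR_le1 (r t : R) : 0 < r -> (`|t| `^ r <= 1) = (`|t| <= 1).
Proof.
move=> r0; apply/idP/idP => [|t1].
  by apply: contraTT; rewrite -!ltNge => t1; rewrite -[X in X < _](congr1 (@^~ r) (powR1 R)) gt0_ltr_powR// nnegrE.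
by rewrite -[X in _ <= X](congr1 (@^~ r) (powR1 R)) ge0_ler_powR// ?nnegrE// ltW.
Qed.

Lemma lq_ball_fin_le1 (r : R) n (x : 'rV[R]_n) i : 0 < r -> lq_ball r%:E n x -> `|x ord0 i| <= 1.
Proof.
move=> r0 /= xr; rewrite -(@powR_le1 r)//; apply: le_trans xr.
by rewrite (bigD1 i)//= lerDl; apply: sumr_ge0 => j _; exact: powR_ge0.
Qed.

Lemma lq_ball_oo n (x : 'rV[R]_n) : lq_ball +oo%E n x <-> forall i, `|x ord0 i| <= 1.
Proof.
split=> /= [h i|h]; last by apply: bigmax_le => // i _; rewrite h.
by apply: le_trans h; exact: le_bigmax.
Qed.

Lemma lq_ball_le1 (q : \bar R) n (x : 'rV[R]_n) i : (1 <= q)%E -> lq_ball q n x -> `|x ord0 i| <= 1.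
Proof.
case: q => [r||]//=; last by move=> _ /lq_ball_oo.
by rewrite lee_fin => r1; apply: lq_ball_fin_le1; exact: lt_le_trans r1.
Qed.

Lemma measurable_lq_ball (q : \bar R) n : (1 <= q)%E -> measurable (lq_ball q n).
Proof.
case: q => [r||]//= q1.
  have mN : measurable_fun setT (fun x : 'rV[R]_n => \sum_i `|x ord0 i| `^ r).
    apply: measurable_sum_fun => i.
    have := @measurable_powR R r; move/measurableT_comp; apply.
    by apply: measurableT_comp => //; exact: measurable_coord.
  rewrite (_ : (fun _ => _) = (fun x : 'rV[R]_n => \sum_i `|x ord0 i| `^ r) @^-1` `]-oo, 1]).
    exact: preimage_measurable.
  by apply/funext => x /=; rewrite in_itv.
rewrite (_ : (fun _ => _) = \bigcap_(i in [set: 'I_n])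
    (fun x : 'rV[R]_n => x ord0 i : measurableTypeR R) @^-1` `[-1, 1]%classic).
  apply: fin_bigcap_measurable => // i _.
  by apply: preimage_measurable; first exact: measurable_coord.
apply/seteqP; split => x /=.
  by move=> /lq_ball_oo h i _ /=; rewrite in_itv /= -ler_norml.
by move=> h; apply/lq_ball_oo => i; have := h i I; rewrite /= in_itv /= -ler_norml.
Qed.

(** The integral of t^e exp(- |t|^(1/p)) over the line when e is even and p > 0,
and of t^e over [-1, 1] when p = 0. *)
Definition power_weight (p : R) (e : nat) : R := 2 / e.+1%:R * Gamma (1 + e.+1%:R * p).

Lemma measurable_monomial n (e : 'I_n -> nat) :
  measurable_fun setT (fun x : 'rV[R]_n => \prod_i x ord0 i ^+ e i).
Proof.
by apply: measurable_prod_fun => i; apply: measurable_funX; exact: measurable_coord.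
Qed.

Lemma Gamma_nat0 : Gamma (1 + 0 : R) = 1.
Proof. exact: (Gamma_nat 0). Qed.

Lemma integral_rV1 (g : R -> R) : measurable_fun setT g -> (forall t, 0 <= g t) ->
  (\int[la 1]_x (g (x ord0 ord0))%:E = \int[mu]_t (g t)%:E)%E.
Proof.
move=> mg g0; have := @integral_rV_prod R 1 (fun=> g) (fun=> mg) (fun=> g0).
by rewrite big_ord1 => <-; apply: eq_integral => x _; rewrite big_ord1.
Qed.

(** The one-dimensional case of [integral_gauge]: the unit ball is [-1, 1] for
every r, so no further substitution is needed. *)
Lemma integral_power_exp (r : R) e : 0 < r -> ~~ odd e ->
  (\int[mu]_t (t ^+ e * expR (- `|t| `^ r))%:E = (power_weight r^-1 e)%:E)%E.
Proof.
move=> r0 ee.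
have mpow : measurable_fun setT (fun t : R => `|t| `^ r).
  have := @measurable_powR R r; move/measurableT_comp; apply.
  exact: normr_measurable.
have mexp : measurable_fun setT (fun t : R => expR (- `|t| `^ r)).
  apply: (measurableT_comp (f := fun x : R => expR (- x))) mpow.
  by apply: continuous_measurable_fun; exact: continuous_expRN.
have g0 (t : R) : 0 <= t ^+ e by rewrite exprn_even_ge0.
have mle : measurable_fun setT (fun t : R => t ^+ e * (`|t| `^ r <= 1)%R%:R).
  by apply: measurable_funM => //; exact: measurable_ler_natr.
have mX : measurable_fun setT (fun x : 'rV[R]_1 => x ord0 ord0 ^+ e).
  by apply: measurable_funX; exact: measurable_coord.
have hX (c : R) (x : 'rV[R]_1) : 0 < c -> (c *: x) ord0 ord0 ^+ e = c ^+ e * x ord0 ord0 ^+ e.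
  by move=> _; rewrite mxE exprMn.
have := integral_gauge r0 mX (fun x => g0 _) hX.
under eq_integral do rewrite big_ord1.
under [X in (_ * X)%E]eq_integral do rewrite big_ord1.
rewrite (@integral_rV1 (fun t => t ^+ e * expR (- `|t| `^ r))); last 2 first.
- by apply: measurable_funM.
- by move=> t; rewrite mulr_ge0 ?expR_ge0.
rewrite (@integral_rV1 (fun t => t ^+ e * (`|t| `^ r <= 1)%R%:R))//; last first.
  by move=> t; rewrite mulr_ge0.
move=> ->; under eq_integral do rewrite powR_le1// mulrC.
rewrite integral_even_power// -GammaE ?divr_ge0 ?(ltW r0)// -EFinM.
by rewrite /power_weight mulrC add1n.
Qed.

Lemma recip_fin (r : R) : 1 <= r -> recip r%:E = r^-1.
Proof. by move=> r1; rewrite /recip fine_invr. Qed.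

Lemma recip_ge0 (q : \bar R) : (1 <= q)%E -> 0 <= recip q.
Proof.
case: q => [r||]// q1.
by rewrite recip_fin ?invr_ge0//; exact: le_trans ler01 q1.
Qed.

Lemma monomial_ge0 n (e : 'I_n -> nat) (x : 'rV[R]_n) : (forall i, ~~ odd (e i)) ->
  0 <= \prod_i x ord0 i ^+ e i.
Proof. by move=> ee; apply: prodr_ge0 => i _; rewrite exprn_even_ge0. Qed.

(** Dirichlet's integral. For q = +oo the ball is a cube and the Gamma factors are
equal to 1. *)
Lemma integral_lq_ball (q : \bar R) n (e : 'I_n -> nat) :
  (1 <= q)%E -> (forall i, ~~ odd (e i)) ->
  ((Gamma (1 + (n + \sum_i e i)%N%:R * recip q))%:E *
   \int[la n]_x (\1_(lq_ball q n) x * \prod_i x ord0 i ^+ e i)%:E)%E =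
  (\prod_i power_weight (recip q) (e i))%:E.
Proof.
case: q => [r||]// q1 ee.
  have r0 : 0 < r by exact: lt_le_trans ltr01 q1.
  have hX (c : R) (x : 'rV[R]_n) : 0 < c ->
      \prod_i (c *: x) ord0 i ^+ e i = c ^+ (\sum_i e i) * \prod_i x ord0 i ^+ e i.
    by move=> _; rewrite -prodrXr -big_split; apply: eq_bigr => i _; rewrite mxE exprMn.
  have := integral_gauge r0 (measurable_monomial e) (fun x => monomial_ge0 x ee) hX.
  rewrite recip_fin// GammaE; last by rewrite divr_ge0// ltW.
  under [X in (_ * X)%E]eq_integral => x _ do rewrite mulrC.
  rewrite (_ : (\int[la n]_x _)%E = (\prod_i power_weight r^-1 (e i))%:E).
    move=> ->; congr (_ * _)%E; apply: eq_integral => x _; congr ((_ * _)%:E).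
    by rewrite indicE; congr ((_ : bool)%:R); apply/idP/idP; rewrite inE.
  rewrite -prodEFin.
  under [RHS]eq_bigr => i _ do rewrite -integral_power_exp//.
  rewrite -(@integral_rV_prod R n (fun i t => t ^+ e i * expR (- `|t| `^ r))); last 2 first.
  - move=> i; apply: measurable_funM => //.
    apply: (measurableT_comp (f := fun x : R => expR (- x))).
      by apply: continuous_measurable_fun; exact: continuous_expRN.
    have := @measurable_powR R r; move/measurableT_comp; apply.
    exact: normr_measurable.
  - by move=> i t; rewrite mulr_ge0 ?expR_ge0 ?exprn_even_ge0.
  apply: eq_integral => x _; rewrite big_split /=; congr ((_ * _)%:E).
  by rewrite -expR_sum -sumrN.
rewrite /recip /inve /= mulr0 Gamma_nat0 mul1e.
transitivity (\int[la n]_x (\prod_i ((`|x ord0 i| <= 1)%R%:R * x ord0 i ^+ e i))%:E)%E.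
  apply: eq_integral => x _; rewrite big_split /=; congr ((_ * _)%:E).
  rewrite indicE; case: (boolP (_ \in _)) => [|].
    by rewrite inE => /lq_ball_oo h; rewrite big1// => i _; rewrite h.
  rewrite notin_setE => /lq_ball_oo h.
  have [i] : exists i, ~~ (`|x ord0 i| <= 1).
    by apply/existsP; apply: contra_notT h; rewrite negb_exists => /forallP h i; have := h i; rewrite negbK.
  by move=> /negbTE hi; rewrite (bigD1 i)//= hi mul0r.
rewrite (@integral_rV_prod R n (fun i t => (`|t| <= 1)%R%:R * t ^+ e i)); last 2 first.
- by move=> i; apply: measurable_funM => //; exact: measurable_ler_natr.
- by move=> i t; rewrite mulr_ge0 ?exprn_even_ge0.
rewrite -prodEFin; apply: eq_bigr => i _.
by rewrite integral_even_power// /power_weight mulr0 Gamma_nat0 mulr1.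
Qed.

End lq_ball.

(** * The convex hull of the points and their opposites *)

Section hull.
Context {R : realType}.

Definition ell1_ball n : set 'rV[R]_n := [set c | \sum_i `|c ord0 i| <= 1].

Lemma convex_setP n (A : set 'rV[R]_n) : @convex_set R 'rV[R]_n A <->
  (forall x y (t : R), 0 <= t <= 1 -> A x -> A y -> A (t *: x + (1 - t) *: y)).
Proof.
split=> [cA x y t /andP[t0 t1] Ax Ay|cA x y t].
  have := cA x y (Itv01 t0 t1); rewrite !inE => /(_ Ax Ay).
  exact.
rewrite !inE => Ax Ay; apply: cA => //; apply/andP; split; [exact: ge0|exact: le1].
Qed.

(** Induction on the number of points: a combination is a convex combination of
one of the points, with the sign of its coefficient, and of a combination of the
remaining ones whose coefficients are rescaled. *)
Lemma convex_set_comb n (A : set 'rV[R]_n) (I : eqType) (x : I -> 'rV[R]_n)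
    (s : seq I) (c : I -> R) :
  @convex_set R 'rV[R]_n A -> A 0 -> (forall i, A (x i) /\ A (- x i)) ->
  \sum_(i <- s) `|c i| <= 1 -> A (\sum_(i <- s) c i *: x i).
Proof.
move=> /convex_setP cA A0 Ax.
elim: s c => [|i s IH] c; first by rewrite !big_nil.
rewrite !big_cons => cle.
have cs0 : 0 <= \sum_(j <- s) `|c j| by apply: sumr_ge0.
have ci : `|c i| <= 1 by lra.
have Asg : A (Num.sg (c i) *: x i).
  case: sgrP => _; rewrite ?scale0r// ?scale1r ?scaleN1r; by have [] := Ax i.
have [c1|c1] := eqVneq `|c i| 1.
  have s0 : \sum_(j <- s) `|c j| = 0 by lra.
  rewrite (_ : \sum_(j <- s) c j *: x j = 0) ?addr0.
    by rewrite [c i]numEsg c1 mulr1.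
  move/eqP : s0; rewrite psumr_eq0// => /allP s0.
  rewrite big_seq big1// => j js; move/(_ _ js): s0 => /=.
  by rewrite normr_eq0 => /eqP ->; rewrite scale0r.
have c1' : 0 < 1 - `|c i| by rewrite subr_gt0 lt_neqAle c1.
have -> : c i *: x i + \sum_(j <- s) c j *: x j =
    `|c i| *: (Num.sg (c i) *: x i) +
    (1 - `|c i|) *: \sum_(j <- s) (c j / (1 - `|c i|)) *: x j.
  rewrite scalerA [`|c i| * _]mulrC -numEsg; congr (_ + _).
  rewrite scaler_sumr; apply: eq_bigr => j _; rewrite scalerA; congr (_ *: _).
  by field; exact: lt0r_neq0.
apply: cA => //; first by rewrite normr_ge0.
apply: IH; under eq_bigr do rewrite normrM normfV (gtr0_norm c1').
by rewrite -mulr_suml ler_pdivrMr// mul1r; lra.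
Qed.

(** The image of the ball is convex and contains the points; conversely every
combination with coefficients of total absolute value at most 1 lies in every
convex set that contains the points and their opposites. For n = 0 the hull is
empty while the image is not. *)
Lemma convex_hull_pm n (x : 'I_n -> 'rV[R]_n) : (0 < n)%N ->
  convex_hull [set y | exists i, y = x i \/ y = - x i] =
  [set c *m (\matrix_i x i) | c in @ell1_ball n].
Proof.
move=> n0; apply/seteqP; split.
  apply: smallest_sub.
    apply/convex_setP => _ _ t /andP[t0 t1] [c cb <-] [d db <-].
    exists (t *: c + (1 - t) *: d); last by rewrite mulmxDl -!scalemxAl.
    rewrite /ell1_ball /= in cb db *.
    apply: (@le_trans _ _ (t * \sum_i `|c ord0 i| + (1 - t) * \sum_i `|d ord0 i|)).
      rewrite !mulr_sumr -big_split /=; apply: ler_sum => i _.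
      rewrite !mxE (le_trans (ler_normD _ _))// !normrM.
      by rewrite (ger0_norm t0) (@ger0_norm _ (1 - t)) ?subr_ge0.
    have : 0 <= t * (1 - \sum_i `|c ord0 i|) by rewrite mulr_ge0// subr_ge0.
    have : 0 <= (1 - t) * (1 - \sum_i `|d ord0 i|) by rewrite mulr_ge0// subr_ge0.
    lra.
  move=> y [i yE].
  have b (e : R) : `|e| <= 1 -> @ell1_ball n (e *: delta_mx 0 i).
    move=> e1; rewrite /ell1_ball /= (bigD1 i)//= !mxE !eqxx mulr1 big1 ?addr0//.
    by move=> j ji; rewrite !mxE (negbTE ji) andbF mulr0 normr0.
  case: yE => ->.
    exists (1 *: delta_mx 0 i); first by apply: b; rewrite normr1.
    by rewrite scale1r -rowE rowK.
  exists (- 1 *: delta_mx 0 i); first by apply: b; rewrite normrN1.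
  by rewrite scaleN1r mulNmx -rowE rowK.
move=> _ [c cb <-] A [cA sA].
have Ax i : A (x i) /\ A (- x i) by split; apply: sA; exists i; [left|right].
have A0 : A 0.
  case: n n0 x c cb A cA sA Ax => // n _ x c cb A cA sA Ax.
  have [Ax0 AN] := Ax ord0.
  move/convex_setP : cA => /(_ _ _ 2^-1 _ Ax0 AN).
  rewrite (_ : 1 - 2^-1 = 2^-1 :> R); last by lra.
  rewrite -scalerDr subrr scaler0; apply; lra.
rewrite mulmx_sum_row; under eq_bigr do rewrite rowK.
exact: convex_set_comb.
Qed.

End hull.

(** * Volume of the hull *)

Section hull_volume.
Context {R : realType}.
Local Notation la n := (@lebesgue_rV R n).

(** Monotonicity without measurability, as the integral of a nonnegative function
is a supremum over the simple functions below it. *)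
Lemma ge0_le_integral_any d (T : measurableType d) (m : {measure set T -> \bar R})
    (f g : T -> \bar R) : (forall x, 0 <= f x)%E -> (forall x, f x <= g x)%E ->
  (\int[m]_x f x <= \int[m]_x g x)%E.
Proof.
move=> f0 fg; rewrite !ge0_integralTE//; last by move=> x; exact: le_trans (fg x).
apply: ub_ereal_sup => _ /= [h hf <-]; apply: ereal_sup_ubound; exists h => //= x.
exact: le_trans (fg x).
Qed.

(** Monotonicity for a set A that need not be measurable; a linear image of a
measurable set by a singular matrix can be such a set. *)
Lemma le_lebesgue_rV n (A B : set 'rV[R]_n) : measurable B -> A `<=` B ->
  (la n A <= la n B)%E.
Proof.
elim: n A B => [|n IHn] A B mB AB.
  rewrite /= !diracE lee_fin ler_nat.
  case: (boolP (_ \in A)) => //; rewrite inE => /AB => B0.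
  by rewrite mem_set.
rewrite !lebesgue_rVSl; apply: ge0_le_integral_any => a; first exact: measure_ge0.
by apply: IHn; [exact: measurable_sectionl|move=> x; exact: AB].
Qed.

Lemma ell1_ballE n : @ell1_ball R n = lq_ball 1%:E n.
Proof.
apply/funext => x; rewrite /ell1_ball /=; congr (is_true (_ <= 1)).
by apply: eq_bigr => i _; rewrite powRr1.
Qed.

Lemma measurable_ell1_ball n : measurable (@ell1_ball R n).
Proof. by rewrite ell1_ballE; exact: measurable_lq_ball. Qed.

Lemma lebesgue_lq_ball (q : \bar R) n : (1 <= q)%E ->
  (la n (lq_ball q n) = (Gamma (1 + n%:R * recip q))^-1%:E *
   ((2 * Gamma (1 + recip q)) ^+ n)%:E)%E.
Proof.
move=> q1; have := @integral_lq_ball R q n (fun=> 0%N) q1 (fun=> isT).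
rewrite big1// addn0.
rewrite (_ : (\int[la n]_x _)%E = la n (lq_ball q n)); last first.
  rewrite -[RHS]mul1e -integral_cst//; last exact: measurable_lq_ball.
  rewrite [RHS]integral_mkcond; apply: eq_integral => x _.
  rewrite patchE big1// mulr1 indicE; by case: ifP.
under eq_bigr do rewrite /power_weight divr1 mul1r.
rewrite prodr_const card_ord => <-; rewrite muleA -EFinM mulVf ?mul1e//.
by rewrite gt_eqF// Gamma_gt0// mulr_ge0// recip_ge0.
Qed.

Lemma lebesgue_lq_ball_gt0 (q : \bar R) n : (1 <= q)%E ->
  exists2 v : R, 0 < v & la n (lq_ball q n) = v%:E.
Proof.
move=> q1; rewrite lebesgue_lq_ball// -EFinM; eexists; last by [].
have p0 := recip_ge0 q1.
by rewrite mulr_gt0 ?invr_gt0 ?exprn_gt0 ?mulr_gt0 ?Gamma_gt0// mulr_ge0.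
Qed.

Lemma lebesgue_ell1_ball n : la n (@ell1_ball R n) = (2 ^+ n / n`!%:R)%:E.
Proof.
rewrite ell1_ballE lebesgue_lq_ball// recip_fin// invr1 mulr1 Gamma_nat -EFinM.
by rewrite (Gamma_nat 1) mulr1 mulrC.
Qed.

Lemma lebesgue_linear_image n (M : 'M[R]_n) (B : set 'rV[R]_n) : \det M != 0 ->
  measurable B -> (la n [set c *m M | c in B] = `|\det M|%:E * la n B)%E.
Proof.
move=> d0 mB.
have uM : M \in unitmx by rewrite unitmxE unitfE.
have dV : \det (invmx M) != 0 by rewrite det_inv invr_eq0.
rewrite -(lebesgue_rV_linear dV mB) muleA -EFinM det_inv normfV divff ?normr_eq0// mul1e.
congr (la n _); apply/seteqP; split => x /=.
  by move=> [c cB <-]; rewrite mulmxK.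
by move=> xB; exists (x *m invmx M) => //; rewrite mulmxKV.
Qed.

(** After multiplication by an invertible matrix the image lies in the hyperplane
where the last coordinate vanishes, which is a null set. *)
Lemma lebesgue_singular_image n (M : 'M[R]_n) (B : set 'rV[R]_n) : \det M = 0 ->
  la n [set c *m M | c in B] = 0%E.
Proof.
move=> d0; apply/eqP; rewrite eq_le measure_ge0 andbT.
have rM : (\rank M < n)%N.
  rewrite ltn_neqAle rank_leq_row andbT; apply: contra_eqN d0 => rn.
  by rewrite -unitfE -unitmxE -row_free_unit /row_free.
case: n M B d0 rM => [|n] M B d0 rM; first by rewrite ltn0 in rM.
(* the hyperplane where the last coordinate vanishes, written as a box *)
pose H := [set x : 'rV[R]_n.+1 | forall i, (if i == ord_max then [set 0] else setT) (x ord0 i)].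
have mH : measurable H.
  rewrite (_ : H = \bigcap_(i in [set: 'I_n.+1])
    (fun x : 'rV[R]_n.+1 => x ord0 i : measurableTypeR R) @^-1` (if i == ord_max then [set 0] else setT)).
    apply: fin_bigcap_measurable => // i _; apply: preimage_measurable; first exact: measurable_coord.
    by case: ifP => _; [exact: measurable_set1|exact: measurableT].
  by apply/seteqP; split => x /= h i; [move=> _|]; exact: h.
have H0 : la n.+1 H = 0%E.
  rewrite (lebesgue_rV_box (A := fun i => if i == ord_max then [set 0] else setT)).
    by rewrite (bigD1 ord_max)//= eqxx lebesgue_measure_set1 mul0e.
  by move=> i; case: ifP => _; [exact: measurable_set1|exact: measurableT].
pose E := row_ebase M; have uE : E \in unitmx := row_ebase_unit M.
have dV : \det (invmx E) != 0 by rewrite det_inv invr_eq0 -unitfE -unitmxE.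
have mP : measurable ((fun x => x *m invmx E) @^-1` H).
  by apply: preimage_measurable => //; exact: measurable_mulmxr.
have P0 : la n.+1 ((fun x => x *m invmx E) @^-1` H) = 0%E.
  have := lebesgue_rV_linear dV mH; rewrite H0 => /eqP.
  by rewrite mule_eq0 eqe normr_eq0 (negbTE dV) => /eqP.
rewrite -P0; apply: le_lebesgue_rV => // _ [c cB <-] i /=.
rewrite -{1}(mulmx_ebase M) !mulmxA mulmxK//.
case: eqP => // ->; rewrite !mxE big1// => j _.
rewrite [pid_mx _ _ _]mxE; case: eqP => [jn|_]; last by rewrite mulr0.
by rewrite jn /= ltnNge -ltnS rM mulr0.
Qed.

(** The volume of the l_1 ball, 2^n / n!, divided by that of the l_q ball, times
the determinant of the matrix of the points. *)
Lemma relative_volumeE (q : \bar R) n (x : 'I_n -> 'rV[R]_n) : (1 <= q)%E -> (0 < n)%N ->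
  relative_volume (lq_ball q n) x =
  Gamma (1 + n%:R * recip q) / (n`!%:R * Gamma (1 + recip q) ^+ n) * `|\det (\matrix_i x i)|.
Proof.
move=> q1 n0; rewrite /relative_volume convex_hull_pm// lebesgue_lq_ball//=.
have p0 := recip_ge0 q1.
have g1 : Gamma (1 + recip q) != 0 by rewrite gt_eqF// Gamma_gt0.
have gn : Gamma (1 + n%:R * recip q) != 0 by rewrite gt_eqF// Gamma_gt0// mulr_ge0.
have [d0|d0] := eqVneq (\det (\matrix_i x i)) 0.
  by rewrite lebesgue_singular_image// d0 normr0 /= !mulr0.
rewrite lebesgue_linear_image//; last exact: measurable_ell1_ball.
rewrite lebesgue_ell1_ball /= exprMn.
have : 2 ^+ n != 0 :> R by rewrite expf_neq0.
have : n`!%:R != 0 :> R by rewrite pnatr_eq0 -lt0n fact_gt0.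
have := expf_neq0 n g1.
move: (Gamma (1 + recip q) ^+ n) (Gamma _) gn (n`!%:R) (2 ^+ n) => a b b0 c e a0 c0 e0.
by field; rewrite a0 b0 c0 e0.
Qed.

End hull_volume.

(** * Expectation of a product of functions of independent variables *)

Section expectation_of_products.
Local Open Scope ereal_scope.

(** The weight G is kept aside: only the factor that depends on X is expanded
into indicator functions. *)
Lemma integral_mul_nnsfun d d' (T : measurableType d) (T' : measurableType d')
    (R : realType) (m : {measure set T -> \bar R}) (X : T -> T') (G : T -> R)
    (h : {nnsfun T' >-> R}) :
  measurable_fun setT X -> measurable_fun setT G -> (forall w, 0 <= G w)%R ->
  \int[m]_w (G w * h (X w))%:E =
  \sum_(r \in range h) r%:E * \int[m]_w (G w * \1_(h @^-1` [set r]) (X w))%:E.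
Proof.
move=> mX mG G0.
have mI r : measurable_fun setT (fun w => (G w * \1_(h @^-1` [set r]) (X w))%R).
  apply: measurable_funM => //.
  have m1 : measurable_fun setT (\1_(h @^-1` [set r]) : T' -> R) by exact: measurable_indic.
  exact: measurableT_comp m1 mX.
under eq_integral => w _.
  rewrite (_ : (G w * h (X w))%:E = \sum_(r \in range h) r%:E * (G w * \1_(h @^-1` [set r]) (X w))%:E); last first.
    rewrite fimfunE mulr_fsumr -fsumEFin//.
    by apply: eq_fsbigr => r _; rewrite -EFinM mulrCA.
  over.
rewrite ge0_integral_fsum//; last 2 first.
- by move=> r; apply: measurable_funeM; exact/measurable_EFinP.
- move=> r w _; rewrite EFinM muleCA mule_ge0 ?lee_fin//.
  exact: nnfun_muleindic_ge0.
apply: eq_fsbigr => r; rewrite inE => -[x _ <-].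
rewrite ge0_integralZl//.
- exact/measurable_EFinP.
- by move=> w _; rewrite lee_fin mulr_ge0.
- by rewrite lee_fin.
Qed.

Lemma cvg_integral_mul_nnsfun d d' (T : measurableType d) (T' : measurableType d')
    (R : realType) (m : {measure set T -> \bar R}) (X : T -> T') (G : T -> R) (f : T' -> R)
    (mX : measurable_fun setT X) (mG : measurable_fun setT G) (G0 : forall w, (0 <= G w)%R)
    (mf : measurable_fun setT (EFin \o f)) (f0 : forall x, (0 <= f x)%R) :
  (fun n => \int[m]_w (G w * nnsfun_approx measurableT mf n (X w))%:E) @ \oo -->
  \int[m]_w (G w * f (X w))%:E.
Proof.
pose h := nnsfun_approx measurableT mf.
rewrite (_ : \int[m]_w (G w * f (X w))%:E =
   \int[m]_w limn (fun n => (G w * h n (X w))%:E)); last first.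
  apply: eq_integral => w _; apply/esym/cvg_lim => //.
  under eq_fun do rewrite EFinM; rewrite EFinM.
  apply: cvgeZl => //.
  by apply: cvg_nnsfun_approx => // x _; rewrite lee_fin.
apply: cvg_monotone_convergence => //.
- move=> n; apply/measurable_EFinP/measurable_funM => //.
  exact: measurableT_comp mX.
- by move=> n w _; rewrite lee_fin mulr_ge0.
- move=> w _ a b ab; rewrite lee_fin ler_wpM2l//.
  exact/lefP/nd_nnsfun_approx.
Qed.

(** The standard extension from indicator functions to nonnegative measurable
functions, for two weighted images of measures at once. It serves both for the law
of a uniform point and for the replacement of one factor in a product. *)
Lemma ge0_integral_comp_eq d1 d2 d' (T1 : measurableType d1) (T2 : measurableType d2)
    (T' : measurableType d') (R : realType)
    (m1 : {measure set T1 -> \bar R}) (m2 : {measure set T2 -> \bar R})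
    (X1 : T1 -> T') (X2 : T2 -> T') (G1 : T1 -> R) (G2 : T2 -> R) :
  measurable_fun setT X1 -> measurable_fun setT X2 ->
  measurable_fun setT G1 -> measurable_fun setT G2 ->
  (forall w, 0 <= G1 w)%R -> (forall w, 0 <= G2 w)%R ->
  (forall A, measurable A ->
    \int[m1]_w (G1 w * \1_A (X1 w))%:E = \int[m2]_w (G2 w * \1_A (X2 w))%:E) ->
  forall f : T' -> R, measurable_fun setT f -> (forall x, 0 <= f x)%R ->
  \int[m1]_w (G1 w * f (X1 w))%:E = \int[m2]_w (G2 w * f (X2 w))%:E.
Proof.
move=> mX1 mX2 mG1 mG2 G10 G20 H f mf f0.
have mf' : measurable_fun setT (EFin \o f) by exact/measurable_EFinP.
pose h := nnsfun_approx measurableT mf'.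
have l1 := cvg_integral_mul_nnsfun (m := m1) mX1 mG1 G10 mf' f0.
have l2 := cvg_integral_mul_nnsfun (m := m2) mX2 mG2 G20 mf' f0.
rewrite -(cvg_lim _ l1)// -(cvg_lim _ l2)//; congr (limn _); apply/funext => n.
rewrite !integral_mul_nnsfun//; apply: eq_fsbigr => r _; congr (_ * _).
by apply: H; exact: measurable_funPTI.
Qed.

Section independence.
Context d d' (T : measurableType d) (T' : measurableType d') (R : realType).
Variable P : probability T R.

Variables (n : nat) (X : 'I_n -> {RV P >-> T'}).
Hypothesis indep : mutually_independent X.

Lemma indep_indic (A : 'I_n -> set T') : (forall i, measurable (A i)) ->
  \int[P]_w (\prod_i \1_(A i) (X i w))%:E = \prod_i \int[P]_w (\1_(A i) (X i w))%:E.
Proof.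
move=> mA; have mXA i : measurable (X i @^-1` A i) by exact: measurable_funPTI.
transitivity (P (\bigcap_(i in [set i | i \in [set: 'I_n]%SET]) X i @^-1` A i)).
  rewrite -[RHS]mul1e -integral_cst; last first.
    by apply: fin_bigcap_measurable => //; exact: finite_finset.
  rewrite [RHS]integral_mkcond; apply: eq_integral => w _; rewrite patchE.
  case: ifPn => [|].
    rewrite inE /= => wA; rewrite big1// => i _.
    by rewrite indicE mem_set//; apply: wA; rewrite /= inE.
  rewrite notin_setE => /existsNP[i /not_implyP[_ /= iA]].
  by rewrite (bigD1 i)//= indicE memNset// mul0r.
rewrite indep//; apply: eq_big => i; first by rewrite inE.
move=> _; rewrite -[LHS]mul1e -integral_cst//.
rewrite integral_mkcond; apply: eq_integral => w _.
rewrite patchE indicE (_ : (w \in _) = (X i w \in A i)); first by case: ifP.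
by apply/idP/idP; rewrite !inE.
Qed.

(** The indicator functions are replaced by the f i one at a time: when all
factors but one are fixed, both sides are weighted integrals of the remaining one,
and [ge0_integral_comp_eq] reduces its case to that of indicator functions. *)
Lemma indep_prod_ge0 (f : 'I_n -> T' -> R) :
  (forall i, measurable_fun setT (f i)) -> (forall i x, (0 <= f i x)%R) ->
  (forall i, \int[P]_w (f i (X i w))%:E < +oo) ->
  \int[P]_w (\prod_i f i (X i w))%:E = \prod_i \int[P]_w (f i (X i w))%:E.
Proof.
suff H k : forall (J : {set 'I_n}) (f : 'I_n -> T' -> R), #|J| = k ->
  (forall i, measurable_fun setT (f i)) -> (forall i x, (0 <= f i x)%R) ->
  (forall i, \int[P]_w (f i (X i w))%:E < +oo) ->
  (forall i, i \notin J -> exists2 A, measurable A & f i = \1_A) ->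
  \int[P]_w (\prod_i f i (X i w))%:E = \prod_i \int[P]_w (f i (X i w))%:E.
  by move=> mf f0 ffin; apply: (H _ [set: 'I_n]%SET) => // i; rewrite inE.
elim: k => [|k IH] J {}f J0 mf f0 ffin fJ.
  have /cards0_eq J00 := J0.
  have {}fJ i : exists A, measurable A /\ f i = \1_A.
    by have [|A mA fA] := fJ i; [rewrite J00 inE|exists A].
  pose A i := sval (cid (fJ i)).
  have AE i : f i = \1_(A i) by rewrite /A; case: cid => /= B [].
  have mA i : measurable (A i) by rewrite /A; case: cid => /= B [].
  under eq_integral do under eq_bigr do rewrite AE.
  by under [RHS]eq_bigr do rewrite AE; exact: indep_indic.
have [j jJ] : exists j, j \in J by apply/set0Pn; rewrite -card_gt0 J0.
pose c := \prod_(i | i != j) \int[P]_w (f i (X i w))%:E.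
pose G w := (\prod_(i | i != j) f i (X i w))%R.
have If0 i : 0 <= \int[P]_w (f i (X i w))%:E by apply: integral_ge0 => w _; rewrite lee_fin.
have : \int[P]_w (G w * f j (X j w))%:E = c * \int[P]_w (f j (X j w))%:E.
  have cfin : c \is a fin_num.
    by rewrite /c; apply: prode_fin_num => i _; rewrite ge0_fin_numE.
  have c0 : (0 <= fine c)%R by rewrite fine_ge0//; apply: prode_ge0.
  have mXj : measurable_fun setT (X j) by [].
  have mulc (g : T' -> R) : measurable_fun setT g -> (forall x, 0 <= g x)%R ->
      c * \int[P]_w (g (X j w))%:E = \int[P]_w (fine c * g (X j w))%:E.
    move=> mg g0; rewrite -[in LHS](fineK cfin) -ge0_integralZl//.
    - by apply/measurable_EFinP; exact: measurableT_comp mg _.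
    - by move=> w _; rewrite lee_fin.
  rewrite mulc//; apply: (@ge0_integral_comp_eq _ _ _ T T _ R P P (X j) (X j) G (cst (fine c))) => //.
  - rewrite /G; under eq_fun do rewrite -big_filter.
    by apply: measurable_prod_fun => i; exact: measurableT_comp (mf i) _.
  - by move=> w; apply: prodr_ge0.
  move=> A mA; transitivity (c * \int[P]_w (\1_A (X j w))%:E); last first.
    by rewrite mulc//; exact: measurable_indic.
  pose g i := if i == j then \1_A else f i.
  have gE i : i != j -> g i = f i by rewrite /g => /negbTE ->.
  have gj : g j = \1_A by rewrite /g eqxx.
  have := IH (J :\ j)%SET g; rewrite (bigD1 j)//= gj.
  have -> : \prod_(i < n | i != j) \int[P]_w (g i (X i w))%:E = c.
    by apply: eq_bigr => i ij; rewrite gE.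
  rewrite muleC => <-.
  - apply: eq_integral => w _; rewrite [in RHS](bigD1 j)//= gj mulrC.
    by congr (_ * _)%:E; apply: eq_bigr => i ij; rewrite gE.
  - by move: J0; rewrite (cardsD1 j) jJ => -[].
  - by move=> i; rewrite /g; case: ifP => // _; exact: measurable_indic.
  - by move=> i x; rewrite /g; case: ifP => // _; rewrite indicE.
  - move=> i; rewrite /g; case: ifP => // _.
    apply: (@le_lt_trans _ _ (\int[P]_w (cst 1 w))).
      apply: ge0_le_integral => //.
      + apply/measurable_EFinP.
        have m1 : measurable_fun setT (\1_A : T' -> R) by exact: measurable_indic.
        exact: measurableT_comp m1 _.
      + by move=> w _; rewrite lee_fin indicE; case: (_ \in _).
    by rewrite integral_cst// mul1e -ge0_fin_numE// fin_num_measure.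
  - move=> i; rewrite in_setD1 negb_and negbK /g; case: eqP => [_ _|_ /= /fJ//].
    by exists A.
move=> cE; rewrite [RHS](bigD1 j)//= muleC -/c -cE.
by apply: eq_integral => w _; rewrite (bigD1 j)//= mulrC.
Qed.

Lemma indep_integrable_prod (f : 'I_n -> T' -> R) :
  (forall i, measurable_fun setT (f i)) ->
  (forall i, P.-integrable setT (fun w => (f i (X i w))%:E)) ->
  P.-integrable setT (fun w => (\prod_i f i (X i w))%:E).
Proof.
move=> mf intf; apply/integrableP; split.
  apply/measurable_EFinP/measurable_prod_fun => i.
  exact: measurableT_comp (mf i) _.
rewrite (_ : \int[P]_w _ = \int[P]_w (\prod_i Num.norm (f i (X i w)))%:E); last first.
  by apply: eq_integral => w _; rewrite /= normr_prod.
have norm_ge0 i : 0 <= \int[P]_w (Num.norm (f i (X i w)))%:E.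
  by apply: integral_ge0 => w _; rewrite lee_fin.
have fin i : \int[P]_w (Num.norm (f i (X i w)))%:E < +oo.
  by have /integrableP[_] := intf i.
rewrite (@indep_prod_ge0 (fun i x => Num.norm (f i x)))//.
  rewrite -ge0_fin_numE; last by apply: prode_ge0.
  by apply: prode_fin_num => i _; rewrite ge0_fin_numE.
by move=> i; apply: measurableT_comp (mf i).
Qed.

(** Again one factor at a time: both sides are additive in each factor, which is
the difference of its positive and negative parts. *)
Lemma indep_prod (f : 'I_n -> T' -> R) :
  (forall i, measurable_fun setT (f i)) ->
  (forall i, P.-integrable setT (fun w => (f i (X i w))%:E)) ->
  P.-integrable setT (fun w => (\prod_i f i (X i w))%:E) /\
  \int[P]_w (\prod_i f i (X i w))%:E = \prod_i \int[P]_w (f i (X i w))%:E.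
Proof.
suff H k : forall (J : {set 'I_n}) (f : 'I_n -> T' -> R), #|J| = k ->
  (forall i, measurable_fun setT (f i)) ->
  (forall i, P.-integrable setT (fun w => (f i (X i w))%:E)) ->
  (forall i, i \notin J -> forall x, (0 <= f i x)%R) ->
  \int[P]_w (\prod_i f i (X i w))%:E = \prod_i \int[P]_w (f i (X i w))%:E.
  move=> mf intf; split; first exact: indep_integrable_prod.
  by apply: (H _ [set: 'I_n]%SET) => // i; rewrite inE.
elim: k => [|k IH] J {}f J0 mf intf fJ.
  have /cards0_eq J00 := J0.
  have f0 i x : (0 <= f i x)%R by apply: fJ; rewrite J00 inE.
  apply: indep_prod_ge0 => // i; have /integrableP[_] := intf i.
  by under eq_integral do rewrite /= ger0_norm//.
have [j jJ] : exists j, j \in J by apply/set0Pn; rewrite -card_gt0 J0.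
pose upd (g : T' -> R) i := if i == j then g else f i.
have updE g i : i != j -> upd g i = f i by rewrite /upd => /negbTE ->.
have updj g : upd g j = g by rewrite /upd eqxx.
pose fp : T' -> R := ((f j)^\+)%R; pose fn : T' -> R := ((f j)^\-)%R.
have mpos : measurable_fun setT fp by exact: measurable_funrpos.
have mneg : measurable_fun setT fn by exact: measurable_funrneg.
have ipos : P.-integrable setT (fun w => (fp (X j w))%:E).
  apply: le_integrable (intf j) => //.
    by apply/measurable_EFinP; exact: measurableT_comp mpos _.
  move=> w _; rewrite lee_fin /= -[in leRHS]/((Num.norm \o f j) _) -funrposDneg.
  by rewrite ger0_norm ?funrpos_ge0// lerDl funrneg_ge0.
have ineg : P.-integrable setT (fun w => (fn (X j w))%:E).
  apply: le_integrable (intf j) => //.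
    by apply/measurable_EFinP; exact: measurableT_comp mneg _.
  move=> w _; rewrite lee_fin /= -[in leRHS]/((Num.norm \o f j) _) -funrposDneg.
  by rewrite ger0_norm ?funrneg_ge0// lerDr funrpos_ge0.
have part (g : T' -> R) : measurable_fun setT g -> (forall x, (0 <= g x)%R) ->
   P.-integrable setT (fun w => (g (X j w))%:E) ->
   P.-integrable setT (fun w => (\prod_i upd g i (X i w))%:E) /\
   \int[P]_w (\prod_i upd g i (X i w))%:E =
   \int[P]_w (g (X j w))%:E * \prod_(i | i != j) \int[P]_w (f i (X i w))%:E.
  move=> mg g0 ig.
  have mu i : measurable_fun setT (upd g i) by rewrite /upd; case: ifP.
  have iu i : P.-integrable setT (fun w => (upd g i (X i w))%:E).
    by rewrite /upd; case: eqP => [->|].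
  split; first exact: indep_integrable_prod.
  rewrite (IH (J :\ j)%SET)//.
  - rewrite (bigD1 j)//= updj; congr (_ * _).
    by apply: eq_bigr => i ij; rewrite updE.
  - by move: J0; rewrite (cardsD1 j) jJ => -[].
  - move=> i; rewrite in_setD1 negb_and negbK /upd; case: eqP => [//|_ /= iJ x].
    exact: fJ.
have [i1 e1] := part _ mpos (funrpos_ge0 _) ipos.
have [i2 e2] := part _ mneg (funrneg_ge0 _) ineg.
transitivity (\int[P]_w ((\prod_i upd fp i (X i w))%:E - (\prod_i upd fn i (X i w))%:E)).
  apply: eq_integral => w _; rewrite -EFinB; congr EFin.
  rewrite (bigD1 j)//= [in RHS](bigD1 j)//= [X in _ = (_ - X)%R](bigD1 j)//= !updj.
  have rest g : (\prod_(i < n | i != j) upd g i (X i w) = \prod_(i < n | i != j) f i (X i w))%R.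
    by apply: eq_bigr => i ij; rewrite updE.
  rewrite !rest.
  by rewrite -mulrBl -[in LHS](funrposBneg (f j)).
rewrite [RHS](bigD1 j)//= integralB_EFin// e1 e2 -muleBl.
- congr (_ * _); rewrite -integralB_EFin//; apply: eq_integral => w _.
  by rewrite -EFinB -[in RHS](funrposBneg (f j)).
- by apply: prode_fin_num => i ij; apply: integrable_fin_num.
- by rewrite fin_num_adde_defl// fin_numN; apply: integrable_fin_num.
Qed.

End independence.

End expectation_of_products.

(** * Moments of the determinant of a matrix with uniform rows *)

Section uniform_moments.
Context {R : realType} (q : \bar R) (n : nat) (q1 : (1 <= q)%E).
Context d (T : measurableType d) (P : probability T R).
Local Notation la := (@lebesgue_rV R n).
Local Notation p := (recip q).
Local Notation K := (lq_ball q n).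

Section one_point.
Variable X : {RV P >-> 'rV[R]_n}.
Hypothesis unifX : uniformly_distributed X K.

Let v := fine (la K).

Lemma volume_gt0 : 0 < v.
Proof. by rewrite /v; have [w w0 ->] := lebesgue_lq_ball_gt0 n q1. Qed.

Lemma volumeE : la K = v%:E.
Proof. by rewrite /v; have [w w0 ->] := lebesgue_lq_ball_gt0 n q1. Qed.

(** The law of X has density v^-1 on K. *)
Lemma expectation_uniform_ge0 (g : 'rV[R]_n -> R) :
  measurable_fun setT g -> (forall x, 0 <= g x) ->
  (\int[P]_w (g (X w))%:E = (v^-1)%:E * \int[la]_x (\1_K x * g x)%:E)%E.
Proof.
move=> mg g0; have mK := @measurable_lq_ball R q n q1.
have m1 : measurable_fun setT (\1_K : 'rV[R]_n -> R) by exact: measurable_indic.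
have mXw : measurable_fun setT X by [].
have key := @ge0_integral_comp_eq _ _ _ T 'rV[R]_n 'rV[R]_n R P la X id
  (cst 1) (fun x => v^-1 * \1_K x).
transitivity (\int[P]_w (cst 1 w * g (X w))%:E)%E.
  by apply: eq_integral => w _; rewrite mul1r.
rewrite key//; last 3 first.
- exact: measurable_funM.
- by move=> x; rewrite mulr_ge0 ?invr_ge0 ?(ltW volume_gt0)// indicE.
- move=> A mA.
  have mXA : measurable (X @^-1` A) by rewrite -[_ @^-1` _]setTI; exact: mXw.
  transitivity (distribution P X A).
    rewrite -[RHS]mul1e -(@integral_cst _ _ _ P (X @^-1` A))//.
    rewrite [RHS]integral_mkcond; apply: eq_integral => w _.
    rewrite patchE mul1r indicE (_ : (w \in _) = (X w \in A)); first by case: ifP.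
    by apply/idP/idP; rewrite !inE.
  rewrite unifX// volumeE inver gt_eqF ?volume_gt0// muleC.
  rewrite -[X in (_ * X)%E]mul1e -integral_cst//; last exact: measurableI.
  rewrite [X in (_ * X)%E]integral_mkcond -ge0_integralZl//; last 3 first.
  - by apply/(measurable_restrict _ _ _) => //; exact: measurableI.
  - by move=> x _; rewrite patchE; case: ifP.
  - by rewrite lee_fin invr_ge0 ltW// volume_gt0.
  apply: eq_integral => x _; rewrite patchE !indicE in_setI andbC.
  by case: (x \in K); case: (x \in A); rewrite ?mulr1 ?mulr0 ?mule1 ?mule0.
rewrite -ge0_integralZl//; last 3 first.
- by apply/measurable_EFinP/measurable_funM.
- by move=> x _; rewrite lee_fin mulr_ge0// indicE.
- by rewrite lee_fin invr_ge0 ltW// volume_gt0.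
by apply: eq_integral => x _; rewrite -EFinM mulrA.
Qed.

Definition flip (j : 'I_n) : 'M[R]_n := diag_mx (\row_i (if i == j then -1 else 1)).

Lemma flipE j (x : 'rV[R]_n) i : (x *m flip j) ord0 i = x ord0 i * (if i == j then -1 else 1).
Proof. by rewrite mul_mx_diag !mxE. Qed.

Lemma flip_abs j (x : 'rV[R]_n) i : `|(x *m flip j) ord0 i| = `|x ord0 i|.
Proof. by rewrite flipE; case: ifP; rewrite ?mulrN1 ?normrN ?mulr1. Qed.

Lemma lq_ball_flip j (x : 'rV[R]_n) : lq_ball q n (x *m flip j) = lq_ball q n x.
Proof.
case: q q1 => [r||]//= _; first by under eq_bigr do rewrite flip_abs.
by under eq_bigr do rewrite flip_abs.
Qed.

Lemma det_flip j : `|\det (flip j)| = 1.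
Proof.
rewrite det_diag normr_prod big1// => i _; rewrite mxE.
by case: ifP; rewrite ?normrN1 ?normr1.
Qed.

Lemma expectation_flip j (g : 'rV[R]_n -> R) :
  measurable_fun setT g -> (forall x, 0 <= g x) ->
  (\int[P]_w (g (X w *m flip j))%:E = \int[P]_w (g (X w))%:E)%E.
Proof.
move=> mg g0.
have mgf : measurable_fun setT (fun x => g (x *m flip j)).
  exact: measurableT_comp mg (measurable_mulmxr _).
rewrite (expectation_uniform_ge0 mgf)// (expectation_uniform_ge0 mg)//; congr (_ * _)%E.
have df : \det (flip j) != 0 by rewrite -normr_gt0 det_flip.
have mK := @measurable_lq_ball R q n q1.
rewrite -(@integral_rV_linear R n (flip j) (fun x => (\1_K x * g x)%:E))//; last 2 first.
- by apply/measurable_EFinP/measurable_funM => //; exact: measurable_indic.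
- by move=> x; rewrite lee_fin mulr_ge0// indicE.
rewrite det_flip mul1e; apply: eq_integral => x _; congr ((_ * _)%:E).
by rewrite !indicE; congr ((_ : bool)%:R); apply/idP/idP; rewrite !inE lq_ball_flip.
Qed.

Lemma integrable_monomial (e : 'I_n -> nat) :
  P.-integrable setT (fun w => (\prod_i X w ord0 i ^+ e i)%:E).
Proof.
have mm := measurable_monomial (R := R) e.
apply/integrableP; split.
  by apply/measurable_EFinP; exact: measurableT_comp mm _.
have mK := @measurable_lq_ball R q n q1.
rewrite (@expectation_uniform_ge0 (fun x => `|\prod_i x ord0 i ^+ e i|))//; last first.
  exact: measurableT_comp.
apply: (@le_lt_trans _ _ ((v^-1)%:E * \int[la]_x (\1_K x)%:E)%E).
  apply: lee_wpmul2l; first by rewrite lee_fin invr_ge0 ltW// volume_gt0.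
  apply: ge0_le_integral => //.
  - by apply/measurable_EFinP/measurable_funM; [exact: measurable_indic|exact: measurableT_comp].
  - by apply/measurable_EFinP; exact: measurable_indic.
  move=> x _; rewrite lee_fin indicE; case: (boolP (_ \in _)); last by rewrite mul0r.
  rewrite inE mul1r => Kx; rewrite normr_prod; apply: prodr_ile1 => i.
  by rewrite normr_ge0 normrX exprn_ile1// (lq_ball_le1 _ q1 Kx).
rewrite (_ : (\int[la]_x _)%E = v%:E) -?EFinM ?ltry//.
by rewrite integral_indic// setIT; exact: volumeE.
Qed.

(** The reflection in the coordinate j changes the sign of the monomial, hence
exchanges its positive and negative parts, which have the same finite expectation. *)
Lemma expectation_odd (e : 'I_n -> nat) j : odd (e j) ->
  (\int[P]_w (\prod_i X w ord0 i ^+ e i)%:E = 0)%E.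
Proof.
move=> ej; set m := fun x : 'rV[R]_n => \prod_i x ord0 i ^+ e i.
have mm : measurable_fun setT m := measurable_monomial e.
have mflip x : m (x *m flip j) = - m x.
  rewrite /m (bigD1 j)//= [in RHS](bigD1 j)//= flipE eqxx mulrN1 exprNn -signr_odd ej.
  rewrite expr1 mulN1r mulNr; congr (- (_ * _)); apply: eq_bigr => i ij.
  by rewrite flipE (negbTE ij) mulr1.
have /integrable_fin_num := integrable_monomial e.
rewrite integralE.
pose mp x := Num.max (m x) 0.
have mmp : measurable_fun setT mp by exact: measurable_maxr.
have mp0 x : 0 <= mp x by rewrite /mp le_max lexx orbT.
have -> : (\int[P]_w (EFin \o (fun w => m (X w)))^\- w = \int[P]_w (mp (X w))%:E)%E.
  rewrite -(expectation_flip j)//; apply: eq_integral => w _.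
  by rewrite funenegE /= -EFin_max /mp mflip.
have -> : (\int[P]_w (EFin \o (fun w => m (X w)))^\+ w = \int[P]_w (mp (X w))%:E)%E.
  by apply: eq_integral => w _; rewrite funeposE /= -EFin_max.
move=> /(_ measurableT); rewrite fin_numB => /andP[fin _].
by rewrite subee.
Qed.

(** The one-dimensional moments that a coordinate would have under the density
proportional to exp(- |t|^q), or under the uniform law on [-1, 1] for q = +oo. *)
Definition rho (e : nat) : R :=
  if odd e then 0 else power_weight p e / (2 * Gamma (1 + p)).

(** Dirichlet's integral [integral_lq_ball] divided by the volume of the ball,
which is its case e = 0. *)
Lemma expectation_monomial (e : 'I_n -> nat) :
  (\int[P]_w (\prod_i X w ord0 i ^+ e i)%:E =
   (Gamma (1 + n%:R * p) / Gamma (1 + (n + \sum_i e i)%N%:R * p) * \prod_i rho (e i))%:E)%E.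
Proof.
have [/existsP[j ej]|] := boolP [exists j, odd (e j)].
  by rewrite (expectation_odd ej) [\prod_i _](bigD1 j)//= /rho ej mul0r mulr0.
rewrite negb_exists => /forallP ee.
rewrite (@expectation_uniform_ge0 (fun x => \prod_i x ord0 i ^+ e i))//; last 2 first.
- exact: measurable_monomial.
- by move=> x; exact: monomial_ge0.
have p0 := recip_ge0 q1.
have := integral_lq_ball q1 ee.
set I := (\int[la]_x _)%E; set g := Gamma (1 + (n + _)%:R * _) => gI.
have g0 : g != 0 by rewrite gt_eqF// Gamma_gt0// mulr_ge0.
have -> : I = (g^-1 * \prod_i power_weight p (e i))%:E.
  by rewrite EFinM -gI muleA -EFinM mulVf// mul1e.
have g1 : Gamma (1 + p) != 0 by rewrite gt_eqF// Gamma_gt0.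
have gn : Gamma (1 + n%:R * p) != 0 by rewrite gt_eqF// Gamma_gt0// mulr_ge0.
rewrite -EFinM; congr EFin.
have -> : \prod_i rho (e i) = \prod_i (power_weight p (e i) / (2 * Gamma (1 + p))).
  by apply: eq_bigr => i _; rewrite /rho (negbTE (ee i)).
rewrite [X in _ = _ * X]big_split /= prodr_const card_ord.
have -> : v = (Gamma (1 + n%:R * p))^-1 * (2 * Gamma (1 + p)) ^+ n.
  by rewrite /v lebesgue_lq_ball.
have h2 : 2 * Gamma (1 + p) != 0 by apply: mulf_neq0 => [|]; [rewrite pnatr_eq0|exact: g1].
have := expf_neq0 n h2; rewrite exprVn.
move: (_ ^+ n) (\prod_i _) gn g0 => a b; move: (Gamma _) => c c0 g0 a0.
by field; rewrite a0 c0 g0.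
Qed.

End one_point.

Let p0 : 0 <= p := recip_ge0 q1.

Let G0 (k : nat) : Gamma (1 + k%:R * p) != 0.
Proof. by rewrite gt_eqF// Gamma_gt0// mulr_ge0. Qed.

Let G1 : Gamma (1 + p) != 0.
Proof. by have := G0 1; rewrite mul1r. Qed.

Lemma rho0 : rho 0 = 1.
Proof.
rewrite /rho /power_weight; move: G1.
by rewrite (mul1r p); move: (Gamma _) => g g0; field.
Qed.

Lemma rho2E : rho 2 = Gamma (1 + 3 * p) / (3 * Gamma (1 + p)).
Proof.
rewrite /rho /power_weight; move: G1.
by move: (Gamma (1 + p)) (Gamma (1 + 3 * p)) => g h g0; field.
Qed.

Lemma rho4E : rho 4 = Gamma (1 + 5 * p) / (5 * Gamma (1 + p)).
Proof.
rewrite /rho /power_weight; move: G1.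
by move: (Gamma (1 + p)) (Gamma (1 + 5 * p)) => g h g0; field.
Qed.

Lemma rho2_neq0 : rho 2 != 0.
Proof.
rewrite rho2E; move: G1 (G0 3).
move: (Gamma (1 + p)) (Gamma (1 + 3 * p)) => g h g0 h0.
by rewrite mulf_neq0// invr_neq0// mulf_neq0.
Qed.

Section independent_points.
Variable X : 'I_n -> {RV P >-> 'rV[R]_n}.
Hypothesis indepX : mutually_independent X.
Hypothesis unifX : forall i, uniformly_distributed (X i) K.

Lemma integral_lincomb (I : finType) (c m : I -> R) (F : I -> T -> R) :
  (forall i, P.-integrable setT (EFin \o F i)) ->
  (forall i, \int[P]_w (F i w)%:E = (m i)%:E)%E ->
  (\int[P]_w (\sum_i c i * F i w)%:E = (\sum_i c i * m i)%:E)%E.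
Proof.
move=> iF mF; under eq_integral do rewrite -sumEFin.
rewrite integral_sum//; last first.
  move=> i; rewrite (_ : (fun _ => _) = (fun x => (c i)%:E * (F i x)%:E)%E).
    by apply: integrableZl => //; exact: iF.
  by apply/funext => x; rewrite EFinM.
rewrite -sumEFin; apply: eq_bigr => i _; under eq_integral do rewrite EFinM.
by rewrite (integralZl measurableT (iF i)) mF.
Qed.

Lemma expectation_prod_monomial (e : 'I_n -> 'I_n -> nat) :
  P.-integrable setT (fun w => (\prod_i \prod_j X i w ord0 j ^+ e i j)%:E) /\
  (\int[P]_w (\prod_i \prod_j X i w ord0 j ^+ e i j)%:E =
   (\prod_i (Gamma (1 + n%:R * p) / Gamma (1 + (n + \sum_j e i j)%N%:R * p) *
     \prod_j rho (e i j)))%:E)%E.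
Proof.
have [h1 h2] := @indep_prod _ _ _ _ _ P n X indepX (fun i x => \prod_j x ord0 j ^+ e i j)
  (fun i => measurable_monomial (e i)) (fun i => integrable_monomial (unifX i) (e i)).
split => //; rewrite h2 -prodEFin; apply: eq_bigr => i _.
exact: expectation_monomial (unifX i) (e i).
Qed.

Lemma prod_exp_delta (x : 'rV[R]_n) (a : 'I_n) : \prod_j x ord0 j ^+ (j == a) = x ord0 a.
Proof. by rewrite (bigD1 a)//= eqxx big1 ?mulr1// => j /negbTE ->. Qed.

Lemma sum_delta (a : 'I_n) : (\sum_(j < n) (j == a) = 1)%N.
Proof. by rewrite (bigD1 a)//= eqxx big1// => j /negbTE ->. Qed.

Let A w : 'M[R]_n := \matrix_i X i w.

(** Only the terms with twice the same permutation have a nonzero expectation. *)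
Lemma expectation_det2 :
  (\int[P]_w (\det (A w) ^+ 2)%:E =
   (n`!%:R * (Gamma (1 + n%:R * p) / Gamma (1 + (n + 2)%N%:R * p) * rho 2) ^+ n)%:E)%E.
Proof.
set C := Gamma (1 + n%:R * p) / Gamma (1 + (n + 2)%N%:R * p).
pose e (s : 'S_n * 'S_n) i j : nat := ((j == s.1 i) + (j == s.2 i))%N.
have eE (s : 'S_n * 'S_n) w : \prod_i (A w i (s.1 i) * A w i (s.2 i)) = \prod_i \prod_j X i w ord0 j ^+ e s i j.
  apply: eq_bigr => i _; rewrite !mxE; under eq_bigr do rewrite exprD.
  by rewrite big_split /= !prod_exp_delta.
under eq_integral do rewrite det_sqr.
rewrite (@integral_lincomb _ _ (fun s : 'S_n * 'S_n => \prod_i (C * (rho 2 * (s.1 i == s.2 i)%:R)))).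
- congr EFin.
  rewrite -(pair_bigA _ (fun s u : 'S_n => (-1) ^+ (s (+) u) *
     \prod_i (C * (rho 2 * (s i == u i)%:R)))) /=.
  rewrite -card_Sn -sum1_card natr_sum mulr_suml; apply: eq_bigr => s _.
  rewrite (bigD1 s)//= addbb mul1r [X in _ + X]big1 ?addr0.
    under eq_bigr do rewrite eqxx mulr1.
    by rewrite prodr_const card_ord mul1r.
  move=> u us; have [i iP] : exists i, s i != u i.
    apply/existsP; apply: contraNT us; rewrite negb_exists => /forallP su.
    by apply/eqP/permP => i; have := su i; rewrite negbK => /eqP.
  by rewrite (bigD1 i)//= (negbTE iP) !mulr0 mul0r mulr0.
- move=> s; have [h _] := expectation_prod_monomial (e s).
  by under eq_fun do rewrite /= eE.
- move=> s; under eq_integral do rewrite eE.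
  have [_ ->] := expectation_prod_monomial (e s); congr EFin; apply: eq_bigr => i _.
  have -> : (\sum_j e s i j = 2)%N by rewrite /e big_split /= !sum_delta.
  rewrite -/C; congr (C * _); exact: (prod_weight2 (s.1 i) (s.2 i) rho0 erefl).
Qed.

(** The row i contributes the moment in the columns s(i), a(s i), b(s i), c(s i),
where s is the reference permutation of [det_exp4]; the product over i is then
reindexed by s, after which it no longer depends on s. *)
Lemma expectation_det4 :
  (\int[P]_w (\det (A w) ^+ 4)%:E =
   (n`!%:R * (Gamma (1 + n%:R * p) / Gamma (1 + (n + 4)%N%:R * p) * rho 2 ^+ 2) ^+ n *
    (n`!%:R * \sum_(k < n.+1) (rho 4 / rho 2 ^+ 2 - 3) ^+ k / k`!%:R * 'C((n - k).+2, 2)%:R))%:E)%E.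
Proof.
set C := Gamma (1 + n%:R * p) / Gamma (1 + (n + 4)%N%:R * p).
set t := rho 4 / _ - 3.
pose e (s : 'S_n * ('S_n * 'S_n * 'S_n)) i j : nat :=
  ((j == s.1 i) + (j == s.2.1.1 (s.1 i)) + (j == s.2.1.2 (s.1 i)) + (j == s.2.2 (s.1 i)))%N.
have eE (s : 'S_n * ('S_n * 'S_n * 'S_n)) w : \prod_i (A w i (s.1 i) * A w i (s.2.1.1 (s.1 i)) *
     A w i (s.2.1.2 (s.1 i)) * A w i (s.2.2 (s.1 i))) =
   \prod_i \prod_j X i w ord0 j ^+ e s i j.
  apply: eq_bigr => i _; rewrite !mxE; under eq_bigr do rewrite !exprD.
  by rewrite !big_split /= !prod_exp_delta.
under eq_integral do rewrite det_exp4 pair_bigA /=.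
rewrite (@integral_lincomb _ _ (fun s : 'S_n * ('S_n * 'S_n * 'S_n) =>
   \prod_i (C * (rho 2 ^+ 2 * fourth_weight t (s.1 i) (s.2.1.1 (s.1 i)) (s.2.1.2 (s.1 i)) (s.2.2 (s.1 i)))))).
- congr EFin; rewrite -sum_fourth_weight.
  rewrite -(pair_bigA _ (fun (s : 'S_n) (u : 'S_n * 'S_n * 'S_n) => (-1) ^+ (u.1.1 (+) u.1.2 (+) u.2) *
     \prod_i (C * (rho 2 ^+ 2 * fourth_weight t (s i) (u.1.1 (s i)) (u.1.2 (s i)) (u.2 (s i)))))) /=.
  rewrite -card_Sn -sum1_card natr_sum !mulr_suml; apply: eq_bigr => s _.
  rewrite mul1r mulr_sumr; apply: eq_bigr => u _.
  rewrite mulrCA; congr (_ * _).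
  rewrite [\prod_i fourth_weight _ i _ _ _](reindex_inj (@perm_inj _ s)) /=.
  have -> : (C * rho 2 ^+ 2) ^+ n = \prod_(i < n) (C * rho 2 ^+ 2).
    by rewrite prodr_const card_ord.
  by rewrite -big_split /=; apply: eq_bigr => i _; rewrite mulrA.
- move=> s; have [h _] := expectation_prod_monomial (e s).
  by under eq_fun do rewrite /= eE.
- move=> s; under eq_integral do rewrite eE.
  have [_ ->] := expectation_prod_monomial (e s); congr EFin; apply: eq_bigr => i _.
  have -> : (\sum_j e s i j = 4)%N by rewrite /e !big_split /= !sum_delta.
  rewrite -/C; congr (C * _).
  exact: (prod_weight4 (s.1 i) (s.2.1.1 (s.1 i)) (s.2.1.2 (s.1 i)) (s.2.2 (s.1 i))
    rho0 erefl rho2_neq0).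
Qed.

Lemma measurable_det : measurable_fun setT (fun w => \det (A w)).
Proof.
apply: measurable_sum_fun => s; apply: measurable_funM; first exact: measurable_cst.
apply: measurable_prod_fun => i.
rewrite (_ : (fun w => _) = (fun x : 'rV[R]_n => x ord0 (s i)) \o X i).
  by apply: measurableT_comp; [exact: measurable_coord|].
by apply/funext => w; rewrite /A !mxE.
Qed.

(** The exponent is even, so the absolute value in [relative_volumeE] disappears. *)
Lemma expectation_relative_volume (k : nat) (m : R) : (0 < n)%N -> ~~ odd k ->
  (\int[P]_w (\det (A w) ^+ k)%:E = m%:E)%E ->
  ('E_P[fun w => (relative_volume K (fun i => X i w) ^+ k)%R])%E =
  ((Gamma (1 + n%:R * p) / (n`!%:R * Gamma (1 + p) ^+ n)) ^+ k * m)%:E.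
Proof.
move=> n0 k2 mE; set c := Gamma _ / _.
have norm_exp (x : R) : `|x| ^+ k = x ^+ k.
  by rewrite -normrX ger0_norm// exprn_even_ge0.
rewrite unlock; under eq_integral do
  rewrite (relative_volumeE _ q1 n0) exprMn norm_exp EFinM.
have c0 : 0 <= c ^+ k by rewrite exprn_even_ge0.
rewrite ge0_integralZl_EFin//.
- by rewrite mE EFinM.
- by move=> w _; rewrite lee_fin exprn_even_ge0.
- apply/measurable_EFinP; apply: measurable_funX; exact: measurable_det.
Qed.

End independent_points.
End uniform_moments.

(** * The second and fourth moments of the relative volume *)

Theorem mainTheorem2 (R : realType) (q : \bar R) (q1 : (1 <= q)%E) :
  let p : R := recip q in
  (forall (n : nat), (1 <= n)%N ->
   forall (d : measure_display) (T : measurableType d) (P : probability T R)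
     (X : 'I_n -> {RV P >-> 'rV[R]_n}),
   mutually_independent X ->
   (forall i, uniformly_distributed (X i) (lq_ball q n)) ->
   ('E_P[fun w => (relative_volume (lq_ball q n) (fun i => X i w) ^+ 2)%R])%E =
   ((n`!%:R)^-1 *
    (Gamma (1 + 3 * p) * Gamma (1 + n%:R * p) /
     (3 * Gamma (1 + p) ^+ 3 * Gamma (1 + (n + 2)%N%:R * p))) ^+ n *
    Gamma (1 + n%:R * p) ^+ 2)%:E)
  /\
  (forall (n : nat), (2 <= n)%N ->
   forall (d : measure_display) (T : measurableType d) (P : probability T R)
     (X : 'I_n -> {RV P >-> 'rV[R]_n}),
   mutually_independent X ->
   (forall i, uniformly_distributed (X i) (lq_ball q n)) ->
   ('E_P[fun w => (relative_volume (lq_ball q n) (fun i => X i w) ^+ 4)%R])%E =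
   (((n + 1)%N%:R * (n + 2)%N%:R) / (2 * n`!%:R ^+ 2) *
    (Gamma (1 + 3 * p) ^+ 2 * Gamma (1 + n%:R * p) /
     (9 * Gamma (1 + p) ^+ 6 * Gamma (1 + (n + 4)%N%:R * p))) ^+ n *
    Gamma (1 + n%:R * p) ^+ 4 *
    phi (A_ q - 3) n)%:E).
Proof.
have p0 := recip_ge0 q1.
have G0 (k : nat) : Gamma (1 + k%:R * recip q) != 0.
  by rewrite gt_eqF// Gamma_gt0// mulr_ge0.
have g0 : Gamma (1 + recip q) != 0 by have := G0 1%N; rewrite mul1r.
have rho2 := rho2E q1; have rho4 := rho4E q1.
move=> p; split=> n n1 d T P X indepX unifX; have n0 : (0 < n)%N by apply: leq_trans n1.
  rewrite (expectation_relative_volume q1 n0 _ (expectation_det2 q1 indepX unifX))//.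
  congr EFin; rewrite rho2 -/p.
  have f0 : n`!%:R != 0 :> R by rewrite pnatr_eq0 -lt0n fact_gt0.
  move: g0 (G0 3%N) (G0 n) (G0 (n + 2)%N) f0; rewrite -/p.
  move: (Gamma (1 + p)) (Gamma (1 + 3 * p)) (Gamma (1 + n%:R * p)) (Gamma (1 + (n + 2)%N%:R * p)) (n`!%:R).
  move=> g g3 gn gn2 f g0 g30 gn0 gn20 f0.
  have -> : g3 * gn / (3 * g ^+ 3 * gn2) = gn / gn2 * (g3 / (3 * g)) / g ^+ 2.
    by field; rewrite g0 gn20.
  rewrite [(_ / g ^+ 2) ^+ n]expr_div_n exprAC.
  move: (_ ^+ n) (g ^+ n) (expf_neq0 n g0) => a b b0.
  by field; rewrite b0 f0.
rewrite (expectation_relative_volume q1 n0 _ (expectation_det4 q1 indepX unifX))//.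
congr EFin.
have -> : rho q 4 / rho q 2 ^+ 2 - 3 = A_ q - 3.
  rewrite rho2 rho4 /A_ -/p; move: g0 (G0 3%N) (G0 5%N); rewrite -/p.
  move: (Gamma (1 + p)) (Gamma (1 + 3 * p)) (Gamma (1 + 5 * p)) => g g3 g5 g0 g30 g50.
  by field; rewrite g0 g30.
have -> : \sum_(k < n.+1) (A_ q - 3) ^+ k / k`!%:R * 'C((n - k).+2, 2)%:R =
    (n + 1)%N%:R * (n + 2)%N%:R / 2 * phi (A_ q - 3) n.
  by rewrite addn1 addn2; exact: sum_exp_binom2.
rewrite rho2 -/p.
have f0 : n`!%:R != 0 :> R by rewrite pnatr_eq0 -lt0n fact_gt0.
move: (phi _ n) ((n + 1)%N%:R) ((n + 2)%N%:R) => ph n1' n2'.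
move: g0 (G0 3%N) (G0 n) (G0 (n + 4)%N) f0; rewrite -/p.
move: (Gamma (1 + p)) (Gamma (1 + 3 * p)) (Gamma (1 + n%:R * p)) (Gamma (1 + (n + 4)%N%:R * p)) (n`!%:R).
move=> g g3 gn gn4 f g0 g30 gn0 gn40 f0.
have -> : g3 ^+ 2 * gn / (9 * g ^+ 6 * gn4) = gn / gn4 * (g3 / (3 * g)) ^+ 2 / g ^+ 4.
  by field; rewrite g0 gn40.
rewrite [(_ / g ^+ 4) ^+ n]expr_div_n [(g ^+ 4) ^+ n]exprAC.
move: (_ ^+ n) (g ^+ n) (expf_neq0 n g0) => a b b0.
by field; rewrite b0 f0.
Qed.
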